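(* Let $\{\mathbf{X}_n\}_{n\ge1}$ be an adapted sequence of random $d\times d$ real symmetric matrices with conditional means $\mathbb{E}(\mathbf{X}_n\mid\mathcal{F}_{n-1})=\mathbf{M}_n$. Let $\{\widehat{\mathbf{X}}_n\}_{n\ge1}$ be a sequence of predictable and integrable random $d\times d$ real symmetric matrices such that $\lambda_{\min}(\mathbf{X}_n-\widehat{\mathbf{X}}_n)\ge-1$ almost surely for all $n$. Then, for any predictable $(0,1)$-valued sequence $\{\gamma_n\}_{n\ge1}$, the process $$L_n=\operatorname{tr}\exp\left(\sum_{i=1}^n\gamma_i(\mathbf{X}_i-\mathbf{M}_i)-\sum_{i=1}^n\psi_{\mathrm{E}}(\gamma_i)(\mathbf{X}_i-\widehat{\mathbf{X}}_i)^2\right),\qquad n\ge0,$$ is a supermartingale. Moreover, writing $$\overline{\mathbf{X}}_n^\gamma=\frac{\gamma_1\mathbf{X}_1+\dots+\gamma_n\mathbf{X}_n}{\gamma_1+\dots+\gamma_n},\qquad\overline{\mathbf{M}}_n^\gamma=\frac{\gamma_1\mathbf{M}_1+\dots+\gamma_n\mathbf{M}_n}{\gamma_1+\dots+\gamma_n},$$ for any $\alpha\in(0,1)$, $$\mathbb{P}\left(\text{there exists }n\ge1,\ \lambda_{\max}\left(\overline{\mathbf{X}}_n^\gamma-\overline{\mathbf{M}}_n^\gamma\right)\ge\frac{\log(d/\alpha)+\lambda_{\max}\left(\sum_{i=1}^n\psi_{\mathrm{E}}(\gamma_i)(\mathbf{X}_i-\widehat{\mathbf{X}}_i)^2\right)}{\gamma_1+\dots+\gamma_n}\right)\le\alpha;$$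 and for any stopping time $\tau$ (with values in $\{1,2,\dots\}\cup\{\infty\}$) and any $\alpha\in(0,1)$, $$\mathbb{P}\left(\tau<\infty\ \text{ and }\ \lambda_{\max}\left(\overline{\mathbf{X}}_\tau^\gamma-\overline{\mathbf{M}}_\tau^\gamma\right)\ge\frac{\log(d/\alpha)+\lambda_{\max}\left(\sum_{i=1}^\tau\psi_{\mathrm{E}}(\gamma_i)(\mathbf{X}_i-\widehat{\mathbf{X}}_i)^2\right)}{\gamma_1+\dots+\gamma_\tau}\right)\le\alpha.$$
   Context: Work on a filtered probability space $(\Omega,\mathcal{F},\mathbb{P})$ with filtration $\{\mathcal{F}_n\}_{n\ge0}$, where $\mathcal{F}_0=\{\varnothing,\Omega\}$. A process $\{X_n\}$ is adapted if $X_n$ is $\mathcal{F}_n$-measurable for all $n$, and predictable if $X_n$ is $\mathcal{F}_{n-1}$-measurable for all $n\ge1$. $\lambda_{\max},\lambda_{\min}$ denote the largest and smallest eigenvalues of a real symmetric matrix, and $\exp$ is the matrix exponential. The function $\psi_{\mathrm{E}}:[0,1)\to[0,\infty)$ is $\psi_{\mathrm{E}}(\gamma)=-\log(1-\gamma)-\gamma$. The empty sum is the zero matrix, so $L_0=d$. Supermartingale means: adapted, with $\mathbb{E}[L_{n+1}\mid\mathcal{F}_n]\le L_n$ almost surely for all $n\ge0$. *)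

(* Defs.v *)
From HB Require Import structures.
From mathcomp Require Import all_boot all_order all_algebra.
From mathcomp Require Import all_classical all_reals all_analysis.
Set Implicit Arguments.
Unset Strict Implicit.
Unset Printing Implicit Defensive.
Import Order.TTheory GRing.Theory Num.Theory.
Import numFieldNormedType.Exports.
Local Open Scope classical_set_scope.
Local Open Scope ring_scope.

Section Matrices.
Context {R : realType} {d : nat}.
Implicit Types A : 'M[R]_d.

(* The limit is taken in the (finite-dimensional) matrix topology. *)
Definition expmx A : 'M[R]_d :=
  limn (series (fun k : nat => (k`!%:R)^-1 *: A ^+ k)).

(* For a symmetric matrix of size d > 0 the set of real eigenvalues is finite
   and nonempty, so that sup and inf are a maximum and a minimum. *)
Definition lambda_max A : R := sup [set a : R | eigenvalue A a].
Definition lambda_min A : R := inf [set a : R | eigenvalue A a].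

End Matrices.

Definition psiE {R : realType} (g : R) : R := - ln (1 - g) - g.

Section Processes.
Context {disp : measure_display} {T : measurableType disp} {R : realType}.
Variable P : probability T R.
Implicit Types (G : set (set T)) (F : nat -> set (set T)).

Definition filtration F : Prop :=
  [/\ forall n, sigma_algebra [set: T] (F n),
      forall n, F n `<=` @measurable _ T &
      forall m n, (m <= n)%N -> F m `<=` F n].

(* Measurability with respect to <<s G>>, which is G when G is a
   sigma-algebra. *)
Definition measurable_wrt G (f : T -> R) : Prop :=
  measurable_fun [set: g_sigma_algebraType G] (f : g_sigma_algebraType G -> R).

Definition mx_measurable_wrt d G (f : T -> 'M[R]_d) : Prop :=
  forall i j, measurable_wrt G (fun w => f w i j).

Definition mx_integrable d (f : T -> 'M[R]_d) : Prop :=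
  forall i j, P.-integrable [set: T] (EFin \o (fun w => f w i j)).

(* Y is a version of the conditional expectation of X given G. *)
Definition cond_expectation G (X Y : T -> R) : Prop :=
  [/\ P.-integrable [set: T] (EFin \o X),
      measurable_wrt G Y,
      P.-integrable [set: T] (EFin \o Y) &
      forall A, G A ->
        (\int[P]_(w in A) (Y w)%:E = \int[P]_(w in A) (X w)%:E)%E].

Definition mx_cond_expectation d G (X Y : T -> 'M[R]_d) : Prop :=
  forall i j, cond_expectation G (fun w => X w i j) (fun w => Y w i j).

(* Conditional expectations are unique up to null sets, so the choice of the
   version Y below is immaterial. *)
Definition supermartingale F (L : nat -> T -> R) : Prop :=
  [/\ forall n, measurable_wrt (F n) (L n),
      forall n, P.-integrable [set: T] (EFin \o L n) &
      forall n, exists2 Y : T -> R, cond_expectation (F n) (L n.+1) Y &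
        {ae P, forall w, Y w <= L n w}].

(* None stands for the value infinity. *)
Definition stopping_time F (tau : T -> option nat) : Prop :=
  forall n, F n [set w | exists2 k, tau w = Some k & (k <= n)%N].

End Processes.

(* All sequences below are indexed from 1; their term of index 0 is unused. *)
Section WeightedSums.
Context {T : Type} {R : realType} {d : nat}.
Implicit Types (gamma : nat -> T -> R) (X Y : nat -> T -> 'M[R]_d).

Definition wsum gamma (n : nat) (w : T) : R :=
  \sum_(1 <= i < n.+1) gamma i w.

Definition wmean gamma X (n : nat) (w : T) : 'M[R]_d :=
  (wsum gamma n w)^-1 *: \sum_(1 <= i < n.+1) gamma i w *: X i w.

Definition wvar gamma X Y (n : nat) (w : T) : 'M[R]_d :=
  \sum_(1 <= i < n.+1) psiE (gamma i w) *: (X i w - Y i w) ^+ 2.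

End WeightedSums.

(* Main.v *)
(* Put D = X_n - Xhat_n, B = gamma_n (M_n - Xhat_n) and let K be the exponent of
   L_(n-1), so that L_n = tr exp(K - B + Y) with Y = gamma_n D - psi_E(gamma_n) D^2.
   Fan's inequality exp(g x - psi_E(g) x^2) <= 1 + g x gives exp Y <= 1 + gamma_n D.
   Lieb's inequality tr exp(K - B + Y) <= tr(C exp Y), where
   C = \int_0^1 R_u e^K R_u du and R_u = ((1 - u) + u e^B)^-1, linearizes the
   dependence on Y: C is F_(n-1)-measurable and positive, so that
   E(L_n | F_(n-1)) <= tr(C (1 + B)) <= tr(C e^B) = tr e^K = L_(n-1).

   For Lieb's inequality, put T = exp(K - B + Y), A = exp Y. The relative entropy
   tr T (log T - log A) = tr T (K - B) is tr (T - A) plus the integral over u of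
   u \sum_ij c_ij (a_j - t_i)^2 / ((1 - u) t_i + u a_j), and each integrand is the
   supremum over Z of a form linear in (T, A). Taking for Z the maximizer at
   (e^K, e^B) gives the lower bound tr T (K - B) + tr T - tr(C A). Integrals over u
   are limits of Riemann sums, which only involve logarithms of real numbers.

   The conditional expectation of tr(C (1 + gamma_n D)) is computed on the events
   where the entries of C are bounded, and monotone convergence gives the
   supermartingale property. The tail bounds are Ville's inequality, since
   tr exp(S - V) >= exp(lambda_max S - lambda_max V). *)
Require Import Defs.
From HB Require Import structures.
From mathcomp Require Import all_boot all_order all_algebra.
From mathcomp Require Import spectral complex.
From mathcomp Require Import all_classical all_reals all_analysis.
From mathcomp Require Import measurable_realfun.
From mathcomp Require Import ring lra.
Import Order.TTheory GRing.Theory Num.Theory.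
Import numFieldNormedType.Exports.
Local Open Scope classical_set_scope.
Local Open Scope ring_scope.
Set Implicit Arguments.
Unset Strict Implicit.
Unset Printing Implicit Defensive.

(** * Spectral theorem *)

Lemma symmetricmxE (R : realType) n (A : 'M[R]_n) :
  (A \is symmetricmx) = (A == A^T).
Proof.
rewrite qualifE /= expr0 scale1r; congr (_ == _).
by apply/matrixP => i j; rewrite !mxE.
Qed.

Lemma symmetricP (R : realType) n (A : 'M[R]_n) :
  reflect (A^T = A) (A \is symmetricmx).
Proof. by rewrite symmetricmxE eq_sym; exact: eqP. Qed.

(** Over the complex numbers the matrix is normal and Hermitian, hence unitarily diagonalizable with
    a real diagonal. Its first diagonal entry is an eigenvalue, and the embedding of [R] reflects
    eigenvalues. *)
Lemma symmetric_eigenvalue (R : realType) n (A : 'M[R]_n.+1) :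
  A^T = A -> exists a, eigenvalue A a.
Proof.
move=> Asym; pose f := real_complex R; pose Ac := map_mx f A.
have Acsym : Ac \is symmetricmx.
  rewrite qualifE /= expr0 scale1r; apply/eqP/matrixP => i j.
  by rewrite !mxE -[in LHS]Asym mxE.
have Acreal : Ac \is a mxOver Num.real.
  by apply/mxOverP => i j; rewrite mxE complex_real.
have /orthomx_spectralP E := symmetric_normalmx Acsym Acreal.
have /mxOverP Dreal :=
  hermitian_spectral_diag_real (realsym_hermsym Acsym Acreal).
have [c cE] : exists c : R, spectral_diag Ac 0 0 = f c.
  by have /complex_realP [c ->] := Dreal 0 0; exists c.
exists c; rewrite -(eigenvalue_map (real_complex R)).
rewrite -[X in eigenvalue X _]/Ac -[X in eigenvalue _ X]/(f c) -cE.
apply/eigenvalueP; exists (row 0 (spectralmx Ac)).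
  rewrite -row_mul [X in _ *m X]E !mulmxA mulmxV ?spectral_unit // mul1mx.
  by apply/rowP => j; rewrite mul_diag_mx !mxE.
(* A row of the invertible matrix of eigenvectors cannot vanish. *)
have := spectral_unit Ac; rewrite -row_free_unit => fr.
apply/negP => /eqP r0.
have := row_free_inj fr; move/(_ 1%N (delta_mx 0 0) 0).
rewrite -rowE r0 mul0mx => /(_ erefl) /matrixP/(_ 0 0).
by rewrite !mxE eqxx => /eqP; rewrite oner_eq0.
Qed.

Lemma mulmx_trE (R : realType) m n (u : 'rV[R]_n) (v : 'M[R]_(m, n)) i :
  (u *m v^T) 0 i = \sum_j u 0 j * v i j.
Proof. by rewrite !mxE; apply: eq_bigr => j _; rewrite mxE. Qed.

Lemma dotmx_ge0 (R : realType) n (u : 'rV[R]_n) : 0 <= (u *m u^T) 0 0.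
Proof. by rewrite mulmx_trE; apply: sumr_ge0 => j _; rewrite -expr2 sqr_ge0. Qed.

Lemma dotmx_eq0 (R : realType) n (u : 'rV[R]_n) :
  ((u *m u^T) 0 0 == 0) = (u == 0).
Proof.
apply/idP/eqP => [|->]; last by rewrite mul0mx mxE.
rewrite mulmx_trE psumr_eq0 => [/allP h|j _]; last by rewrite -expr2 sqr_ge0.
apply/rowP => j; have := h j (mem_index_enum _).
by rewrite -expr2 sqrf_eq0 mxE => /eqP.
Qed.

(** Reflection in the hyperplane orthogonal to [u = e - v], which exchanges the unit vectors [e] and
    [v]; for [u = 0] the identity serves. *)
Lemma householder (R : realType) n (v : 'rV[R]_n.+1) : v *m v^T = 1%:M ->
  exists2 H : 'M[R]_n.+1, H^T = H /\ H *m H = 1%:M & delta_mx 0 0 *m H = v.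
Proof.
move=> v1; pose e : 'rV[R]_n.+1 := delta_mx 0 0.
have [u uE] : {u | u = e - v} by exists (e - v).
have [u0|u0] := eqVneq u 0.
  exists 1%:M; first by rewrite trmx1 mul1mx.
  by rewrite mulmx1; apply/subr0_eq; rewrite -uE.
pose c := (u *m u^T) 0 0.
have c0 : c != 0 by rewrite dotmx_eq0.
have uu : u *m u^T = c%:M by apply/matrixP => i j; rewrite !ord1 [in RHS]mxE eqxx.
exists (1%:M - (2 / c) *: (u^T *m u)); first split.
- by rewrite linearB /= linearZ /= trmx_mul trmxK trmx1.
- rewrite mulmxBl mul1mx mulmxBr mulmx1 -scalemxAl -scalemxAr mulmxA.
  rewrite -[u^T *m u *m _]mulmxA uu mul_mx_scalar -scalemxAl !scalerA.
  have -> : 2 / c * (2 / c * c) = 2 / c + 2 / c by field.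
  by rewrite scalerDl opprB addrK subrK.
have -> : delta_mx 0 0 = e by [].
(* As [e] and [v] are unit vectors, [|e - v|^2 = 2 - 2 <e, v> = 2 <e, u>]. *)
have eu : e *m u^T = (c / 2)%:M.
  have ee : e *m e^T = 1%:M.
    by apply/matrixP => i j; rewrite !ord1 -rowE !mxE.
  have cE : c%:M = e *m u^T + e *m u^T :> 'M[R]_1.
    have ve : v *m e^T = e *m v^T.
      by rewrite -[RHS]trmxK [(_ *m _)^T in RHS]trmx_mul trmxK (mx11_scalar (v *m _)) tr_scalar_mx.
    rewrite -uu {1}uE mulmxBl uE linearB /= !mulmxBr ve ee v1.
    by rewrite opprB addrACA [- _ + _]addrC addrACA.
  apply/matrixP => i j; rewrite !ord1; move/matrixP/(_ 0 0): cE.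
  by rewrite !mxE eqxx !mulr1n => ->; field.
rewrite mulmxBr mulmx1 -scalemxAr mulmxA eu mul_scalar_mx scalerA.
have -> : 2 / c * (c / 2) = 1 by field.
by rewrite scale1r uE subKr.
Qed.

(** Deflation by induction on the size: a reflection sends a unit eigenvector to the first basis
    vector, and symmetry then splits off a block of size 1. *)
Theorem symmetric_spectral (R : realType) n (A : 'M[R]_n) : A^T = A ->
  exists Q : 'M[R]_n, exists2 a : 'rV[R]_n,
    Q *m Q^T = 1%:M & A = Q^T *m diag_mx a *m Q.
Proof.
elim: n A => [|n IH] A Asym.
  by exists 1%:M, 0; [rewrite mul1mx trmx1|apply/matrixP => -[]].
have [l /eigenvalueP [v0 v0A v00]] := symmetric_eigenvalue Asym.
pose c := (v0 *m v0^T) 0 0.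
have c0 : 0 < c by rewrite lt_def dotmx_eq0 v00 dotmx_ge0.
pose v := (Num.sqrt c)^-1 *: v0.
have vA : v *m A = l *: v by rewrite -scalemxAl v0A !scalerA mulrC.
have v1 : v *m v^T = 1%:M.
  rewrite linearZ /= -scalemxAl -scalemxAr scalerA.
  apply/matrixP => i j; rewrite !ord1 mxE -/c [in RHS]mxE eqxx.
  by rewrite -expr2 exprVn sqr_sqrtr ?ltW // mulVf ?gt_eqF.
have [H [Hsym HH] eH] := householder v1.
pose A1 := H *m A *m H.
have A1sym : A1^T = A1 by rewrite !trmx_mul Hsym Asym mulmxA.
have eA1 : (delta_mx 0 0 : 'rV[R]_n.+1) *m A1 = l *: delta_mx 0 0.
  rewrite /A1 !mulmxA eH vA -scalemxAl; congr (_ *: _).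
  by rewrite -[v]eH -mulmxA HH mulmx1.
(* [A2] is [A1] retyped at size [1 + n], so that block decompositions apply. *)
have [A2 A2A1] : {B : 'M[R]_(1 + n) | B = A1} by exists A1.
have A2E : A2 = block_mx l%:M 0 0 (drsubmx A2).
  have r0 (i j : 'I_(1 + n)) : i = 0%N :> nat -> A2 i j = l * (0%N == j)%:R.
    move=> i0; have -> : i = 0 by exact: val_inj.
    have := eA1; rewrite -A2A1 -rowE => /matrixP/(_ 0 j).
    by rewrite !mxE eqxx /= eq_sym.
  have s0 (i j : 'I_(1 + n)) : A2 j i = A2 i j by rewrite [in LHS]A2A1 -A1sym -A2A1 mxE.
  rewrite -[LHS]submxK; congr block_mx; apply/matrixP => i j; rewrite !ord1 !mxE.
  - by rewrite r0 // mulr1 mulr1n.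
  - by rewrite r0 // mulr0.
  - by rewrite s0 r0 // mulr0.
have [|Q1 [a1 Q1o A1E]] := IH (drsubmx A2).
  by rewrite trmx_drsub [in LHS]A2A1 A1sym -A2A1.
pose Q2 : 'M[R]_(1 + n) := block_mx 1%:M 0 0 Q1.
have Q2o : Q2 *m Q2^T = 1%:M.
  rewrite /Q2 tr_block_mx mulmx_block !trmx1 !trmx0 !(mulmx0, mul0mx, addr0, add0r).
  by rewrite mulmx1 Q1o -scalar_mx_block.
have {}A2E : A2 = Q2^T *m diag_mx (row_mx l%:M a1) *m Q2.
  rewrite A2E diag_mx_row tr_block_mx !mulmx_block !trmx1 !trmx0.
  rewrite !(mulmx0, mul0mx, addr0, add0r, mulmx1, mul1mx) A1E.
  by congr block_mx; apply/matrixP => i j; rewrite !ord1 !mxE.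
exists (Q2 *m H), (row_mx l%:M a1).
  by rewrite trmx_mul mulmxA -[_ *m H *m _]mulmxA Hsym HH mulmx1.
have -> : A = H *m A2 *m H.
  by rewrite A2A1 /A1 !mulmxA HH mul1mx -mulmxA HH mulmx1.
by rewrite A2E trmx_mul Hsym !mulmxA.
Qed.

(** * Riemann sums for the logarithm *)

Section RiemannSums.
Variable R : realType.
Implicit Types (f F : R -> R) (x y u v : R).

(** Left-endpoint Riemann sum over the unit interval. With [N.+1] cells the mesh is always defined,
    and every node lies in [[0, 1)]. *)
Definition riemann_avg f (N : nat) : R :=
  N.+1%:R^-1 * \sum_(k < N.+1) f (k%:R / N.+1%:R).

Definition segm x y u := (1 - u) * x + u * y.

Lemma riemann_point (N : nat) (k : 'I_N.+1) :
  0 <= k%:R / N.+1%:R :> R /\ k%:R / N.+1%:R < 1 :> R.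
Proof.
split; first by rewrite divr_ge0.
by rewrite ltr_pdivrMr ?ltr0Sn // mul1r ltr_nat.
Qed.

Lemma eq_riemann_avg f g : (forall u, 0 <= u < 1 -> f u = g u) ->
  riemann_avg f =1 riemann_avg g.
Proof.
move=> fg N; congr (_ * _); apply: eq_bigr => k _; apply: fg.
by have [-> ->] := riemann_point k.
Qed.

Lemma le_riemann_avg f g N : (forall u, 0 <= u < 1 -> f u <= g u) ->
  riemann_avg f N <= riemann_avg g N.
Proof.
move=> fg; rewrite ler_pM2l ?invr_gt0 ?ltr0Sn //; apply: ler_sum => k _.
by apply: fg; have [-> ->] := riemann_point k.
Qed.

Lemma riemann_avgD f g N :
  riemann_avg (fun u => f u + g u) N = riemann_avg f N + riemann_avg g N.
Proof. by rewrite /riemann_avg -mulrDr -big_split. Qed.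

Lemma riemann_avgB f g N :
  riemann_avg (fun u => f u - g u) N = riemann_avg f N - riemann_avg g N.
Proof. by rewrite /riemann_avg sumrB mulrBr. Qed.

Lemma riemann_avgZ c f N :
  riemann_avg (fun u => c * f u) N = c * riemann_avg f N.
Proof. by rewrite /riemann_avg -mulr_sumr mulrCA. Qed.

Lemma riemann_avg_sum (I : Type) (r : seq I) (f : I -> R -> R) N :
  riemann_avg (fun u => \sum_(i <- r) f i u) N =
  \sum_(i <- r) riemann_avg (f i) N.
Proof. by rewrite /riemann_avg exchange_big mulr_sumr. Qed.

Lemma riemann_avg_cst c N : riemann_avg (fun=> c) N = c.
Proof.
by rewrite /riemann_avg sumr_const card_ord -(mulr_natl c) mulKf // pnatr_eq0.
Qed.

Lemma riemann_avg_telescope F f N :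
  riemann_avg f N - (F 1 - F 0) = \sum_(k < N.+1)
    (N.+1%:R^-1 * f (k%:R / N.+1%:R)
     - (F (k.+1%:R / N.+1%:R) - F (k%:R / N.+1%:R))).
Proof.
rewrite sumrB /riemann_avg mulr_sumr; congr (_ - _).
rewrite -(big_mkord predT (fun k => F (k.+1%:R / _) - F (k%:R / _))).
rewrite (telescope_sumr (fun k => F (k%:R / N.+1%:R))) //.
by rewrite divff ?pnatr_eq0 // mul0r.
Qed.

(** [F] acts as a primitive of [f]. A cell of width [h] has error at most [C h^2], so the [N.+1]
    cells contribute at most [C / N.+1] in total. *)
Lemma riemann_avg_cvg F f C :
  (forall u v, 0 <= u -> u <= v -> v <= 1 ->
     `|(v - u) * f u - (F v - F u)| <= C * (v - u) ^+ 2) ->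
  riemann_avg f N @[N --> \oo] --> F 1 - F 0.
Proof.
move=> Fb; apply/subr_cvg0/norm_cvg0P.
have C0 : C * harmonic n @[n --> \oo] --> (0 : R).
  by rewrite -[X in _ --> X](mulr0 C); apply: cvgM (cvg_cst _) cvg_harmonic.
apply: (squeeze_cvgr _ (cvg_cst 0) C0); near=> N.
rewrite normr_ge0 /= riemann_avg_telescope; apply: le_trans (ler_norm_sum _ _ _) _.
have -> : C * harmonic N = \sum_(k < N.+1) C * (N.+1%:R^-1) ^+ 2.
  rewrite sumr_const card_ord -(mulr_natl (C * _)) /harmonic /=.
  have : N.+1%:R != 0 :> R by rewrite pnatr_eq0.
  by move: (N.+1%:R : R) => n n0; field.
apply: ler_sum => k _.
have E : k.+1%:R / N.+1%:R - k%:R / N.+1%:R = N.+1%:R^-1 :> R.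
  by rewrite -mulrBl -natr1 addrAC subrr add0r mul1r.
rewrite -[X in X * f _]E -[X in C * X ^+ 2]E; apply: Fb.
- by rewrite divr_ge0.
- by rewrite ler_pM2r ?invr_gt0 ?ltr0Sn // ler_nat.
- by rewrite ler_pdivrMr ?ltr0Sn // mul1r ler_nat.
Unshelve. all: by end_near. Qed.

Lemma segm_ge_min x y u : 0 <= u <= 1 -> Num.min x y <= segm x y u.
Proof.
move=> /andP[u0 u1]; rewrite /segm.
have [xy|xy] := leP x y; nra.
Qed.

Lemma segm_gt0 x y u : 0 < x -> 0 < y -> 0 <= u <= 1 -> 0 < segm x y u.
Proof.
by move=> x0 y0 u01; apply: lt_le_trans (segm_ge_min x y u01); rewrite lt_min x0.
Qed.

Lemma ln_le_subr1 x : 0 < x -> ln x <= x - 1.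
Proof.
move=> x0; have := expR_ge1Dx (ln x); rewrite lnK ?posrE //; lra.
Qed.

Lemma ln_sub_bounds x y : 0 < x -> 0 < y ->
  (y - x) / y <= ln y - ln x <= (y - x) / x.
Proof.
move=> x0 y0; rewrite -ln_div ?posrE //; apply/andP; split.
  have := ln_le_subr1 (divr_gt0 x0 y0).
  rewrite [ln (x / y)]ln_div ?posrE // ln_div ?posrE //.
  by rewrite mulrBl divff ?gt_eqF //; lra.
have := ln_le_subr1 (divr_gt0 y0 x0).
by rewrite mulrBl divff ?gt_eqF //; lra.
Qed.

Lemma segmB x y u v : segm x y v - segm x y u = (v - u) * (y - x).
Proof. by rewrite /segm; ring. Qed.

Lemma segm0 x y : segm x y 0 = x.
Proof. by rewrite /segm; ring. Qed.

Lemma segm1 x y : segm x y 1 = y.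
Proof. by rewrite /segm; ring. Qed.

Section ln_avg.
Variables (x y : R) (x0 : 0 < x) (y0 : 0 < y).

Let m := Num.min x y.
Let m0 : 0 < m. Proof. by rewrite lt_min x0. Qed.

(** The primitive is [ln] along the segment. The two bounds of [ln_sub_bounds] confine the error of
    a cell with end values [a] and [b] to [(b - a)^2 / (a b)], and both values are at least [m]. *)
Lemma ln_sub_cvg :
  riemann_avg (fun u => (y - x) / segm x y u) N @[N --> \oo] --> ln y - ln x.
Proof.
have := @riemann_avg_cvg (fun u => ln (segm x y u))
  (fun u => (y - x) / segm x y u) ((y - x) ^+ 2 / m ^+ 2).
rewrite segm0 segm1; apply => u v u0 uv v1.
have su : m <= segm x y u by apply: segm_ge_min; rewrite u0 (le_trans uv).
have sv : m <= segm x y v by apply: segm_ge_min; rewrite v1 (le_trans u0).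
have su0 := lt_le_trans m0 su; have sv0 := lt_le_trans m0 sv.
have /andP[lo hi] := ln_sub_bounds su0 sv0.
move: lo hi; rewrite mulrA -segmB.
set a := segm x y u in su su0 *; set b := segm x y v in sv sv0 * => lo hi.
have -> : (y - x) ^+ 2 / m ^+ 2 * (v - u) ^+ 2 = (b - a) ^+ 2 / m ^+ 2.
  by rewrite /a /b segmB; ring.
rewrite ger0_norm; last by rewrite subr_ge0.
apply: (@le_trans _ _ ((b - a) / a - (b - a) / b)); first by rewrite lerD2l lerN2.
have -> : (b - a) / a - (b - a) / b = (b - a) ^+ 2 / (a * b).
  by field; rewrite !gt_eqF.
by rewrite ler_wpM2l ?sqr_ge0 // lef_pV2 ?posrE ?exprn_gt0 ?mulr_gt0 // expr2 ler_pM // ltW.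
Qed.

(* Each Riemann sum dominates the integral, since the integrand is
   nonincreasing. *)
Lemma ln_sub_le N :
  ln y - ln x <= riemann_avg (fun u => (y - x) / segm x y u) N.
Proof.
rewrite -subr_ge0.
have := @riemann_avg_telescope (fun u => ln (segm x y u))
  (fun u => (y - x) / segm x y u) N.
rewrite segm0 segm1 => ->; apply: sumr_ge0 => k _; rewrite subr_ge0.
have k1 : k.+1%:R / N.+1%:R <= 1 :> R.
  by rewrite ler_pdivrMr ?ltr0Sn // mul1r ler_nat.
have [k0 k1'] := riemann_point k.
have su0 : 0 < segm x y (k%:R / N.+1%:R) by apply: segm_gt0; rewrite // k0 ltW.
have sv0 : 0 < segm x y (k.+1%:R / N.+1%:R) by apply: segm_gt0; rewrite // k1 divr_ge0.
have /andP[_] := ln_sub_bounds su0 sv0.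
rewrite segmB -mulrBl -natr1 addrAC subrr add0r mul1r => /le_trans; apply.
by rewrite mulrA.
Qed.

(** The primitive [u / (x * segm x y u)] vanishes at 0, equals [(x * y)^-1] at 1, and avoids a
    division by [y - x]. *)
Lemma inv_sq_cvg :
  riemann_avg (fun u => (segm x y u ^+ 2)^-1) N @[N --> \oo] --> (x * y)^-1.
Proof.
have := @riemann_avg_cvg (fun u => u / (x * segm x y u))
  (fun u => (segm x y u ^+ 2)^-1) (`|y - x| / m ^+ 3).
rewrite segm1 mul0r subr0 mul1r; apply => u v u0 uv v1.
have su : m <= segm x y u by apply: segm_ge_min; rewrite u0 (le_trans uv).
have sv : m <= segm x y v by apply: segm_ge_min; rewrite v1 (le_trans u0).
have su0 := lt_le_trans m0 su; have sv0 := lt_le_trans m0 sv.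
have -> : (v - u) / segm x y u ^+ 2 - (v / (x * segm x y v) - u / (x * segm x y u))
    = (v - u) ^+ 2 * ((y - x) / (segm x y u ^+ 2 * segm x y v)).
  by move: su0 sv0; rewrite /segm => su0 sv0; field; rewrite !gt_eqF.
rewrite normrM ger0_norm ?sqr_ge0 // mulrC ler_wpM2r ?sqr_ge0 //.
rewrite normrM normfV; apply: ler_wpM2l => //.
rewrite gtr0_norm ?mulr_gt0 ?exprn_gt0 //.
rewrite lef_pV2 ?posrE ?mulr_gt0 ?exprn_gt0 // [leLHS]exprSr.
by apply: ler_pM; rewrite ?exprn_ge0 ?(ltW m0) // lerXn2r // nnegrE ltW.
Qed.

End ln_avg.

(* Inverse of the first divided difference of [expR] at [ln a] and [ln b]. *)
Definition ln_quot (a b : R) :=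
  if a == b then a^-1 else (ln a - ln b) / (a - b).

Lemma ln_quotxx a : ln_quot a a = a^-1.
Proof. by rewrite /ln_quot eqxx. Qed.

Lemma ln_quotM c a b : 0 < c -> 0 < a -> 0 < b ->
  ln_quot (c * a) (c * b) = c^-1 * ln_quot a b.
Proof.
move=> c0 a0 b0; rewrite /ln_quot.
have -> : (c * a == c * b) = (a == b) by apply/inj_eq/mulfI; rewrite gt_eqF.
case: ifP => _; first by rewrite invfM.
rewrite !lnM ?posrE // -mulrBr invfM opprD addrACA subrr add0r.
by rewrite mulrCA.
Qed.

(** Partial fractions reduce the integrand to two logarithmic ones unless [y * x' = x * y']; in that
    case the segments are proportional and the integrand is a multiple of an inverse square. *)
Lemma inv_segmM_cvg x y x' y' : 0 < x -> 0 < y -> 0 < x' -> 0 < y' ->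
  riemann_avg (fun u => (segm x y u * segm x' y' u)^-1) N @[N --> \oo]
    --> ln_quot (y * x') (x * y').
Proof.
move=> x0 y0 x'0 y'0; rewrite /ln_quot; have [E|E] := eqVneq (y * x') (x * y').
  have {E} y'E : y' = x' / x * y by rewrite mulrAC [x' * y]mulrC E mulrAC divff ?mul1r ?gt_eqF.
  rewrite (_ : (fun N => _) = fun N => (x / x') * riemann_avg (fun u => (segm x y u ^+ 2)^-1) N).
    rewrite (_ : (y * x')^-1 = (x / x') * (x * y)^-1); last by field; rewrite !gt_eqF.
    exact: cvgM (cvg_cst _) (inv_sq_cvg x0 y0).
  apply/funext => N; rewrite -riemann_avgZ; apply: eq_riemann_avg => u /andP[u0 u1].
  have s0 : 0 < segm x y u by apply: segm_gt0; rewrite // u0 ltW.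
  rewrite y'E (_ : segm x' _ u = x' / x * segm x y u); last first.
    by rewrite /segm; field; rewrite gt_eqF.
  by field; rewrite !gt_eqF.
rewrite -subr_eq0 in E.
rewrite (_ : (fun N => _) = fun N => (y * x' - x * y')^-1 *
    (riemann_avg (fun u => (y - x) / segm x y u) N -
     riemann_avg (fun u => (y' - x') / segm x' y' u) N)).
  rewrite [X in _ --> X]mulrC !lnM ?posrE //.
  rewrite (_ : ln y + ln x' - (ln x + ln y') = (ln y - ln x) - (ln y' - ln x')); last by ring.
  apply: cvgM; first exact: cvg_cst.
  by apply: cvgB; apply: ln_sub_cvg.
apply/funext => N.
rewrite -riemann_avgB -riemann_avgZ.
apply: eq_riemann_avg => u /andP[u0 u1].
have s0 : 0 < segm x y u by apply: segm_gt0; rewrite // u0 ltW.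
have s'0 : 0 < segm x' y' u by apply: segm_gt0; rewrite // u0 ltW.
move: s0 s'0; rewrite /segm => s0 s'0.
by field; rewrite E !gt_eqF.
Qed.

(* Fan's inequality: with [y = g x >= - g], the integrand of
   [y - ln (1 + y) = \int_0^1 u y^2 / (1 + u y)] is at most
   [x^2] times the one obtained for [y = - g]. *)
Lemma fan_ln g x : 0 < g < 1 -> -1 <= x ->
  g * x - psiE g * x ^+ 2 <= ln (1 + g * x).
Proof.
move=> /andP[g0 g1] x1.
have gx : 0 < 1 + g * x by nra.
have g1' : 0 < 1 - g by lra.
have L1 : (x ^+ 2 * (riemann_avg (fun u => (1 - g - 1) / segm 1 (1 - g) u) N + g))
    @[N --> \oo] --> x ^+ 2 * (ln (1 - g) - ln 1 + g).
  by apply: cvgM (cvg_cst _) _; apply: cvgD (ln_sub_cvg _ _) (cvg_cst _).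
have L2 : (riemann_avg (fun u => (1 + g * x - 1) / segm 1 (1 + g * x) u) N - g * x)
    @[N --> \oo] --> ln (1 + g * x) - ln 1 - g * x.
  by apply: cvgB (ln_sub_cvg _ _) (cvg_cst _).
suff : x ^+ 2 * (ln (1 - g) - ln 1 + g) <= ln (1 + g * x) - ln 1 - g * x.
  by rewrite /psiE ln1; lra.
apply: ler_cvg_to L1 L2 _; near=> N.
(* Constants become averages of constants, so that the two sides can be compared node by node. *)
rewrite -[X in _ <= _ - X](riemann_avg_cst _ N) -[X in _ * (_ + X)](riemann_avg_cst _ N).
rewrite -riemann_avgB -riemann_avgD -riemann_avgZ.
apply: le_riemann_avg => u /andP[u0 u1].
have s1 : 0 < segm 1 (1 - g) u by apply: segm_gt0; rewrite // u0 ltW.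
have s2 : 0 < segm 1 (1 + g * x) u by apply: segm_gt0; rewrite // u0 ltW.
have -> : x ^+ 2 * ((1 - g - 1) / segm 1 (1 - g) u + g) =
    - (u * (g * x) ^+ 2 / segm 1 (1 - g) u).
  by move: s1; rewrite /segm => s1; field; apply: lt0r_neq0; lra.
have -> : (1 + g * x - 1) / segm 1 (1 + g * x) u - g * x =
    - (u * (g * x) ^+ 2 / segm 1 (1 + g * x) u).
  by move: s2; rewrite /segm => s2; field; apply: lt0r_neq0; lra.
rewrite lerN2; apply: ler_wpM2l; first by rewrite mulr_ge0 ?sqr_ge0.
by rewrite lef_pV2 ?posrE // /segm lerD2l; apply: ler_wpM2l => //; nra.
Unshelve. all: by end_near. Qed.

Lemma fan_expR g x : 0 < g < 1 -> -1 <= x ->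
  expR (g * x - psiE g * x ^+ 2) <= 1 + g * x.
Proof.
move=> g01 x1; have gx : 0 < 1 + g * x by case/andP: g01 => g0 g1; nra.
by rewrite -[leRHS]lnK ?posrE // ler_expR fan_ln.
Qed.

End RiemannSums.

(** * Matrix exponential and largest eigenvalue *)

Lemma cvg_sumr (R : realType) (I : Type) (r : seq I) (f : I -> nat -> R) (l : I -> R) :
  (forall i, f i N @[N --> \oo] --> l i) ->
  (\sum_(i <- r) f i N) @[N --> \oo] --> \sum_(i <- r) l i.
Proof.
move=> fl; elim: r => [|i r IH].
  by rewrite big_nil; under eq_fun do rewrite big_nil; exact: cvg_cst.
by rewrite big_cons; under eq_fun do rewrite big_cons; exact: cvgD.
Qed.

(** Neighbourhoods of a matrix contain boxes of entrywise neighbourhoods, and finitely many eventual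
    conditions hold together. *)
Lemma mx_cvg (R : realType) m n (A : nat -> 'M[R]_(m, n)) (L : 'M[R]_(m, n)) :
  (forall i j, A N i j @[N --> \oo] --> L i j) -> A N @[N --> \oo] --> L.
Proof.
move=> AL B [P PL PB].
have : \forall N \near \oo, forall i j, P i j (A N i j).
  by apply: filter_forall => i; apply: filter_forall => j; apply: AL; exact: PL.
by apply: filterS => N PN; apply: PB.
Qed.

Lemma mx_lim (R : realType) m n (A : nat -> 'M[R]_(m, n)) (L : 'M[R]_(m, n)) :
  (forall i j, A N i j @[N --> \oo] --> L i j) -> limn A = L.
Proof. by move=> AL; apply: cvg_lim; [exact: norm_hausdorff|exact: mx_cvg]. Qed.

Section Spectral.
Variables (R : realType) (n : nat).
Implicit Types (Q A B X Y : 'M[R]_n) (a b : 'rV[R]_n).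

(** For orthogonal [Q], the symmetric matrix whose eigenvectors are the rows of [Q], with
    eigenvalues [a]; functions of the matrix then act on [a] alone. *)
Definition sdiag Q a := Q^T *m diag_mx a *m Q.

Lemma sdiag_sym Q a : (sdiag Q a)^T = sdiag Q a.
Proof. by rewrite !trmx_mul trmxK tr_diag_mx mulmxA. Qed.

Lemma sdiagE Q a i j : sdiag Q a i j = \sum_k a 0 k * (Q k i * Q k j).
Proof.
rewrite /sdiag mul_mx_diag !mxE; apply: eq_bigr => k _.
by rewrite !mxE -mulrA mulrCA.
Qed.

Lemma orthogonalC Q : Q *m Q^T = 1%:M -> Q^T *m Q = 1%:M.
Proof. exact: mulmx1C. Qed.

Lemma sdiagM Q a b : Q *m Q^T = 1%:M ->
  sdiag Q a *m sdiag Q b = sdiag Q (\row_j (a 0 j * b 0 j)).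
Proof.
move=> Qo; rewrite /sdiag !mulmxA -[_ *m Q *m Q^T]mulmxA Qo mulmx1.
by rewrite -[_ *m diag_mx a *m _]mulmxA mulmx_diag.
Qed.

Lemma sdiag_const Q c : Q *m Q^T = 1%:M -> sdiag Q (const_mx c) = c%:M.
Proof.
move=> Qo; rewrite /sdiag diag_const_mx mul_mx_scalar -scalemxAl.
by rewrite orthogonalC // scalemx1.
Qed.

Lemma sdiagD Q a b : sdiag Q (a + b) = sdiag Q a + sdiag Q b.
Proof. by rewrite /sdiag linearD /= mulmxDr mulmxDl. Qed.

Lemma sdiagB Q a b : sdiag Q (a - b) = sdiag Q a - sdiag Q b.
Proof. by rewrite /sdiag linearB /= mulmxBr mulmxBl. Qed.

Lemma sdiagZ Q c a : sdiag Q (c *: a) = c *: sdiag Q a.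
Proof. by rewrite /sdiag linearZ /= -scalemxAr -scalemxAl. Qed.

Lemma sdiag_exp Q a k : Q *m Q^T = 1%:M ->
  sdiag Q a ^+ k = sdiag Q (\row_j a 0 j ^+ k).
Proof.
move=> Qo; elim: k => [|k IH].
  rewrite expr0; apply: etrans (esym (sdiag_const 1 Qo)) _; congr sdiag.
  by apply/rowP => j; rewrite !mxE expr0.
rewrite exprS IH; apply: etrans (sdiagM _ _ Qo) _; congr sdiag.
by apply/rowP => j; rewrite !mxE exprS.
Qed.

Lemma mxtrace_sdiag Q a : Q *m Q^T = 1%:M -> \tr (sdiag Q a) = \sum_j a 0 j.
Proof. by move=> Qo; rewrite /sdiag mxtrace_mulC mulmxA Qo mul1mx mxtrace_diag. Qed.

(** Powers act on the eigenvalues, so each entry of a partial sum is a fixed finite combination of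
    partial sums of scalar exponential series. *)
Lemma expmx_series_cvg Q a : Q *m Q^T = 1%:M -> forall i j,
  (series (fun k : nat => (k`!%:R)^-1 *: sdiag Q a ^+ k)) N i j @[N --> \oo]
    --> sdiag Q (map_mx expR a) i j.
Proof.
move=> Qo i j; rewrite sdiagE.
rewrite (_ : (fun N => _) = fun N =>
    \sum_k (series (exp_coeff (a 0 k)) N * (Q k i * Q k j))).
  apply: cvg_sumr => k; apply: cvgM (cvg_cst _); rewrite mxE.
  exact: is_cvg_series_exp_coeff.
apply/funext => N; rewrite /series /=.
under [RHS]eq_bigr do rewrite mulr_suml.
rewrite exchange_big /= summxE; apply: eq_bigr => l _.
rewrite mxE sdiag_exp // sdiagE mulr_sumr; apply: eq_bigr => k _.
by rewrite mxE [LHS]mulrA; congr (_ * _); rewrite mulrC.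
Qed.

Lemma expmx_sdiag Q a : Q *m Q^T = 1%:M ->
  expmx (sdiag Q a) = sdiag Q (map_mx expR a).
Proof. by move=> Qo; apply: mx_lim; exact: expmx_series_cvg. Qed.

(** Guarantees that the limit defining [expmx] exists; measurability of the matrix exponential is
    deduced from this pointwise convergence. *)
Lemma expmx_cvg A : A^T = A -> forall i j,
  (series (fun k : nat => (k`!%:R)^-1 *: A ^+ k)) N i j @[N --> \oo]
    --> expmx A i j.
Proof.
move=> /symmetric_spectral [Q [a Qo ->]] i j.
by rewrite -/(sdiag Q a) expmx_sdiag //; exact: expmx_series_cvg.
Qed.

Lemma expmx_sym A : A^T = A -> (expmx A)^T = expmx A.
Proof.
move=> /symmetric_spectral [Q [a Qo ->]].
by rewrite -/(sdiag Q a) expmx_sdiag // sdiag_sym.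
Qed.

Lemma quad_sdiag Q a (x : 'rV[R]_n) :
  (x *m sdiag Q a *m x^T) 0 0 = \sum_k a 0 k * (x *m Q^T) 0 k ^+ 2.
Proof.
have -> : x *m sdiag Q a *m x^T = (x *m Q^T) *m diag_mx a *m (x *m Q^T)^T.
  by rewrite /sdiag trmx_mul trmxK !mulmxA.
rewrite mul_mx_diag mxE; apply: eq_bigr => k _.
by rewrite !mxE mulrAC mulrC -expr2.
Qed.

Lemma eigenvalue_sdiag Q a x : Q *m Q^T = 1%:M ->
  eigenvalue (sdiag Q a) x <-> exists k, x = a 0 k.
Proof.
move=> Qo; split=> [/eigenvalueP [v vA v0]|[k ->]].
  have Qv : v *m Q^T != 0.
    apply: contraNneq v0 => /(congr1 (mulmx^~ Q)).
    by rewrite -mulmxA orthogonalC // mulmx1 mul0mx => ->.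
  have E : (v *m Q^T) *m diag_mx a = x *: (v *m Q^T).
    by rewrite scalemxAl -vA /sdiag -!mulmxA Qo mulmx1.
  have /rV0Pn [k vk] := Qv; exists k.
  move/rowP/(_ k): E; rewrite mul_mx_diag [LHS]mxE [RHS]mxE mulrC.
  by move/(mulIf vk).
apply/eigenvalueP; exists (row k Q).
  by rewrite /sdiag -row_mul !mulmxA Qo mul1mx; apply/rowP => j; rewrite mul_diag_mx !mxE.
apply/eqP => r0; move/matrixP/(_ k k): Qo.
rewrite !mxE eqxx big1 => [/eqP|j _]; first by rewrite eq_sym oner_eq0.
by move/rowP/(_ j): r0; rewrite !mxE => ->; rewrite mul0r.
Qed.

Lemma eigen_bounded Q a : Q *m Q^T = 1%:M ->
  has_ubound [set x | eigenvalue (sdiag Q a) x] /\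
  has_lbound [set x | eigenvalue (sdiag Q a) x].
Proof.
move=> Qo; split; [exists (\sum_k `|a 0 k|)|exists (- \sum_k `|a 0 k|)];
  move=> x /(eigenvalue_sdiag _ _ Qo) [k ->].
  by rewrite (bigD1 k) //= ler_wpDr ?sumr_ge0 // ler_norm.
rewrite (bigD1 k) //= opprD ler_wnDr // ?oppr_le0 ?sumr_ge0 //.
by rewrite lerNl ler_normr lexx orbT.
Qed.

Lemma lambda_max_ge Q a k : Q *m Q^T = 1%:M ->
  a 0 k <= lambda_max (sdiag Q a).
Proof.
move=> Qo; apply: ub_le_sup; first exact: (eigen_bounded a Qo).1.
by apply/(eigenvalue_sdiag _ _ Qo); exists k.
Qed.

Lemma lambda_min_le Q a k : Q *m Q^T = 1%:M ->
  lambda_min (sdiag Q a) <= a 0 k.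
Proof.
move=> Qo; apply: ge_inf; first exact: (eigen_bounded a Qo).2.
by apply/(eigenvalue_sdiag _ _ Qo); exists k.
Qed.

End Spectral.

(** * Rayleigh's principle and trace bounds for the largest eigenvalue *)

Section LambdaMax.
Variables (R : realType) (n : nat).
Implicit Types (Q A B : 'M[R]_n.+1) (a : 'rV[R]_n.+1).

Lemma lambda_max_attained Q a : Q *m Q^T = 1%:M ->
  exists k, lambda_max (sdiag Q a) = a 0 k.
Proof.
move=> Qo; have [k kmax] : exists k, forall j, a 0 j <= a 0 k.
  have [k _ kmax] := @arg_maxP _ _ _ ord0 predT (fun j => a 0 j) erefl.
  by exists k => j; apply: kmax.
exists k; apply/eqP; rewrite eq_le lambda_max_ge // andbT.
apply: ge_sup; first by exists (a 0 k); apply/(eigenvalue_sdiag _ _ Qo); exists k.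
by move=> x /(eigenvalue_sdiag _ _ Qo) [j ->].
Qed.

(** In the eigenbasis the quadratic form is a combination of the eigenvalues weighted by the squared
    coordinates of [x]. The row of [Q] belonging to the largest eigenvalue attains the bound. *)
Lemma lambda_maxP A : A^T = A ->
  (exists2 x : 'rV[R]_n.+1, (x *m x^T) 0 0 = 1 & (x *m A *m x^T) 0 0 = lambda_max A) /\
  (forall x : 'rV[R]_n.+1, (x *m A *m x^T) 0 0 <= lambda_max A * (x *m x^T) 0 0).
Proof.
move=> /symmetric_spectral [Q [a Qo ->]]; rewrite -/(sdiag Q a).
have dotE (x : 'rV[R]_n.+1) : (x *m x^T) 0 0 = \sum_k (x *m Q^T) 0 k ^+ 2.
  have -> : x *m x^T = (x *m Q^T) *m (x *m Q^T)^T.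
    by rewrite trmx_mul trmxK mulmxA -[x *m _ *m Q]mulmxA orthogonalC // mulmx1.
  by rewrite mulmx_trE; apply: eq_bigr => k _; rewrite expr2.
split; last first.
  move=> x; rewrite quad_sdiag dotE mulr_sumr; apply: ler_sum => k _.
  by rewrite ler_wpM2r ?sqr_ge0 // lambda_max_ge.
have [k ->] := lambda_max_attained a Qo.
have rQ j : (row k Q *m Q^T) 0 j = (k == j)%:R by rewrite -row_mul Qo !mxE.
exists (row k Q).
  rewrite dotE (bigD1 k) //= rQ eqxx expr1n big1 ?addr0 // => j.
  by rewrite eq_sym => /negPf jk; rewrite rQ jk expr0n.
rewrite quad_sdiag (bigD1 k) //= rQ eqxx expr1n mulr1 big1 ?addr0 // => j.
by rewrite eq_sym => /negPf jk; rewrite rQ jk expr0n mulr0.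
Qed.

(** All three forms are evaluated at a unit vector attaining [lambda_max A]. *)
Lemma lambda_max_subadd A B : A^T = A -> B^T = B ->
  lambda_max A - lambda_max B <= lambda_max (A - B).
Proof.
move=> As Bs; have [[x x1 <-] _] := lambda_maxP As.
have [_ /(_ x)] := lambda_maxP Bs; rewrite x1 mulr1 => xB.
have [|_ /(_ x)] := @lambda_maxP (A - B); first by rewrite linearB /= As Bs.
rewrite x1 mulr1; apply: le_trans.
by rewrite mulmxBr mulmxBl [leRHS]mxE [X in _ <= _ + X]mxE lerD2l lerN2.
Qed.

Lemma lambda_maxZ c A : 0 < c -> A^T = A ->
  lambda_max (c *: A) = c * lambda_max A.
Proof.
move=> c0 /symmetric_spectral [Q [a Qo ->]]; rewrite -/(sdiag Q a) -sdiagZ.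
have [j jE] := lambda_max_attained (c *: a) Qo.
have [k kE] := lambda_max_attained a Qo.
apply/eqP; rewrite eq_le; apply/andP; split.
  by rewrite jE mxE ler_pM2l // lambda_max_ge.
by rewrite kE; have := lambda_max_ge (c *: a) k Qo; rewrite mxE.
Qed.

(** The trace is a sum of [n.+1] positive exponentials, the largest being [expR (lambda_max A)]. The
    lower bound drives the tail estimates; both bounds enter [lambda_max_cvg]. *)
Lemma mxtrace_expmx_bounds A : A^T = A ->
  expR (lambda_max A) <= \tr (expmx A) <= n.+1%:R * expR (lambda_max A).
Proof.
move=> /symmetric_spectral [Q [a Qo ->]]; rewrite -/(sdiag Q a).
rewrite expmx_sdiag // mxtrace_sdiag //; apply/andP; split.
  have [k ->] := lambda_max_attained a Qo.
  by rewrite (bigD1 k) //= mxE lerDl sumr_ge0 // => j _; rewrite mxE expR_ge0.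
rewrite mulr_natl -[X in _ *+ X](card_ord n.+1) -sumr_const; apply: ler_sum => k _.
by rewrite mxE ler_expR lambda_max_ge.
Qed.

(** Log-sum-exp smoothing, with error at most [ln n.+1 / N.+1]. It exhibits [lambda_max] as a
    pointwise limit of functions whose measurability is clear. *)
Lemma lambda_max_cvg A : A^T = A ->
  (N.+1%:R^-1 * ln (\tr (expmx (N.+1%:R *: A)))) @[N --> \oo] --> lambda_max A.
Proof.
move=> As.
have L : lambda_max A + harmonic N * ln n.+1%:R @[N --> \oo] --> lambda_max A.
  rewrite -[X in _ --> X]addr0 -[X in _ + X](mul0r (ln n.+1%:R)).
  by apply: cvgD (cvg_cst _) _; apply: cvgM cvg_harmonic (cvg_cst _).
apply: squeeze_cvgr (cvg_cst (lambda_max A)) L; near=> N.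
have N0 : 0 < N.+1%:R :> R by rewrite ltr0Sn.
have /mxtrace_expmx_bounds : (N.+1%:R *: A)^T = N.+1%:R *: A by rewrite linearZ /= As.
rewrite lambda_maxZ // => /andP[lo hi].
have tr0 := lt_le_trans (expR_gt0 _) lo.
rewrite ler_pdivlMl // -[X in X <= _]expRK ler_ln ?posrE ?expR_gt0 // lo /=.
rewrite ler_pdivrMl // mulrDr /harmonic /= mulVKf ?gt_eqF //.
rewrite -[X in X + _]expRK -lnM ?posrE ?expR_gt0 ?ltr0Sn //.
rewrite ler_ln ?posrE ?mulr_gt0 ?expR_gt0 ?ltr0Sn //.
by rewrite mulrC.
Unshelve. all: by end_near. Qed.

End LambdaMax.

(** * Lower bound on the relative entropy *)

Section TraceExpansion.
Variables (R : realType) (n : nat).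
Implicit Types (P G T A X Y Z : 'M[R]_n).

Lemma mxtrace_mulE X Y : \tr (X *m Y) = \sum_i \sum_k X i k * Y k i.
Proof. by rewrite /mxtrace; apply: eq_bigr => i _; rewrite mxE. Qed.

Lemma mxtrace_conj P X : P *m P^T = 1%:M -> \tr (P *m X *m P^T) = \tr X.
Proof. by move=> Po; rewrite mxtrace_mulC mulmxA orthogonalC // mul1mx. Qed.

Lemma mxtrace_trmul3 X T Y : \tr (X^T *m (T *m Y)) =
  \sum_i \sum_k \sum_j T i k * (X i j * Y k j).
Proof.
rewrite mxtrace_mulE exchange_big /=; apply: eq_bigr => i _.
rewrite exchange_big /=; apply: eq_bigr => j _; rewrite !mxE.
by rewrite mulr_sumr; apply: eq_bigr => k _; rewrite mulrCA.
Qed.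

(** Two orthonormal bases are used at once, [P] on the side of [T] and [G] on the other; when [P]
    diagonalizes [T], the triple sum collapses to a double one. *)
Lemma mxtrace_midl P G T X Y : P *m P^T = 1%:M -> G *m G^T = 1%:M ->
  \tr (X^T *m T *m Y) = \sum_i \sum_k \sum_j
    (P *m T *m P^T) i k * ((P *m X *m G^T) i j * (P *m Y *m G^T) k j).
Proof.
move=> Po Go; rewrite -(mxtrace_conj _ Go) -mxtrace_trmul3; congr mxtrace.
rewrite !trmx_mul trmxK !mulmxA.
rewrite -[_ *m P^T *m P]mulmxA orthogonalC // mulmx1.
by rewrite -[_ *m P^T *m P]mulmxA orthogonalC // mulmx1.
Qed.

Lemma mxtrace_midr P G A X Y : P *m P^T = 1%:M -> G *m G^T = 1%:M ->
  \tr (X *m A *m Y^T) = \sum_j \sum_l \sum_i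
    (G *m A *m G^T) j l * ((P *m X *m G^T) i j * (P *m Y *m G^T) i l).
Proof.
(* The mirror image of [mxtrace_midl]: transposes, with the two bases exchanged. *)
move=> Po Go; rewrite -{1}[X]trmxK (mxtrace_midl A X^T Y^T Go Po).
apply: eq_bigr => j _; apply: eq_bigr => l _; apply: eq_bigr => i _.
have tE (B : 'M[R]_n) p q : (G *m B^T *m P^T) p q = (P *m B *m G^T) q p.
  by rewrite -[G]trmxK -trmx_mul -trmx_mul mulmxA mxE trmxK.
by rewrite !tE.
Qed.

Lemma sdiagK P (a : 'rV[R]_n) : P *m P^T = 1%:M -> P *m sdiag P a *m P^T = diag_mx a.
Proof. by move=> Po; rewrite /sdiag !mulmxA Po mul1mx -mulmxA Po mulmx1. Qed.

Lemma sum_diag_mx (a : 'rV[R]_n) (f : 'I_n -> 'I_n -> 'I_n -> R) :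
  \sum_i \sum_k \sum_j diag_mx a i k * f i k j = \sum_i \sum_j a 0 i * f i i j.
Proof.
apply: eq_bigr => i _; rewrite (bigD1 i) //= [X in _ + X]big1 ?addr0 => [|k ki].
  by apply: eq_bigr => j _; rewrite mxE eqxx mulr1n.
by apply: big1 => j _; rewrite mxE eq_sym (negPf ki) mulr0n mul0r.
Qed.

Lemma row_orthogonal P G i k : P *m P^T = 1%:M -> G *m G^T = 1%:M ->
  \sum_j (P *m G^T) i j * (P *m G^T) k j = (i == k)%:R.
Proof.
move=> Po Go; transitivity ((P *m G^T *m (P *m G^T)^T) i k).
  by rewrite [RHS]mxE; apply: eq_bigr => j _; rewrite [X in _ = _ * X]mxE.
rewrite trmx_mul trmxK mulmxA -[_ *m _ *m G]mulmxA orthogonalC // mulmx1 Po.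
by rewrite mxE.
Qed.

End TraceExpansion.

Section Entropy.
Variable R : realType.

(* With [t = expR s] and [a = expR e], this integrates over [u] the bound
   [2 z o (a - t) - z ^ 2 m <= o ^ 2 (a - t) ^ 2 / m], [m = segm t a u]. *)
Lemma entropy_scalar_ge (s e o : R) (z : R -> R) N :
  (expR s - expR e) * o ^+ 2 +
  riemann_avg (fun u => u * (2 * (z u * o * (expR e - expR s))
     - z u ^+ 2 * segm (expR s) (expR e) u)) N
  <= expR s * (s - e) * o ^+ 2.
Proof.
have := ln_sub_le (expR_gt0 s) (expR_gt0 e) N; rewrite !expRK => le_avg.
have t0 := expR_gt0 s; have a0 := expR_gt0 e.
move: (expR s) (expR e) t0 a0 le_avg => t a t0 a0 le_avg.
apply: (@le_trans _ _ ((t - a) * o ^+ 2 +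
  riemann_avg (fun u => - (t * o ^+ 2 * ((a - t) / segm t a u)) - (t - a) * o ^+ 2) N)).
  rewrite lerD2l; apply: le_riemann_avg => u /andP[u0 u1].
  have m0 : 0 < segm t a u by apply: segm_gt0; rewrite // u0 ltW.
  have -> : - (t * o ^+ 2 * ((a - t) / segm t a u)) - (t - a) * o ^+ 2 =
      u * ((a - t) * o) ^+ 2 / segm t a u.
    by move: m0; rewrite /segm => m0; field; rewrite gt_eqF.
  rewrite -[leRHS]mulrA; apply: ler_wpM2l => //.
  rewrite -subr_ge0.
  have -> : ((a - t) * o) ^+ 2 / segm t a u -
      (2 * (z u * o * (a - t)) - z u ^+ 2 * segm t a u) =
      ((a - t) * o - z u * segm t a u) ^+ 2 / segm t a u.
    by field; rewrite gt_eqF.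
  by rewrite divr_ge0 ?sqr_ge0 ?ltW.
rewrite riemann_avgB riemann_avg_cst.
under eq_riemann_avg do rewrite -mulNr.
rewrite riemann_avgZ.
have : 0 <= t * o ^+ 2 by rewrite mulr_ge0 ?sqr_ge0 ?ltW.
have -> : t * (s - e) * o ^+ 2 = t * o ^+ 2 * (s - e) by ring.
move: (t * o ^+ 2) (riemann_avg _ _) le_avg => c r le_avg c0.
by have := ler_wpM2l c0 le_avg; lra.
Qed.

Variable n : nat.
Implicit Types (P G T A X Y Z : 'M[R]_n).

(** Linear in [(T, A)] for fixed [Z]. For positive [T] and [A] it is a concave quadratic in [Z],
    whose supremum is the relative entropy integrand without its factor [u]. *)
Definition tangent_form T A Z u :=
  2 * \tr (Z^T *m (A - T)) - (1 - u) * \tr (Z^T *m T *m Z)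
  - u * \tr (Z *m A *m Z^T).

(** In the eigenbases of [T] and [A] every trace is a sum over pairs of eigenvalues, and
    [entropy_scalar_ge] applies to each pair. The bound holds for every Riemann sum, before any
    limit. *)
Lemma entropy_ge U V (s e : 'rV[R]_n) T A (Z : R -> 'M[R]_n) N :
  U *m U^T = 1%:M -> V *m V^T = 1%:M ->
  T = sdiag U (map_mx expR s) -> A = sdiag V (map_mx expR e) ->
  \tr T - \tr A + riemann_avg (fun u => u * tangent_form T A (Z u) u) N
  <= \tr (T *m (sdiag U s - sdiag V e)).
Proof.
move=> Uo Vo TE AE.
(* The squared entries of [O] are the overlaps of the two eigenbases, by which every pair is
   weighted. *)
pose O := U *m V^T; pose z u := U *m Z u *m V^T.
have O1 : U *m 1%:M *m V^T = O by rewrite mulmx1.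
have trl X Y : \tr (X^T *m T *m Y) = \sum_i \sum_j
    expR (s 0 i) * ((U *m X *m V^T) i j * (U *m Y *m V^T) i j).
  rewrite (mxtrace_midl _ _ _ Uo Vo) TE sdiagK // sum_diag_mx.
  by apply: eq_bigr => i _; apply: eq_bigr => j _; rewrite mxE.
have trr X Y : \tr (X *m A *m Y^T) = \sum_i \sum_j
    expR (e 0 j) * ((U *m X *m V^T) i j * (U *m Y *m V^T) i j).
  rewrite (mxtrace_midr _ _ _ Uo Vo) AE sdiagK // sum_diag_mx exchange_big /=.
  by apply: eq_bigr => i _; apply: eq_bigr => j _; rewrite mxE.
have trT : \tr T = \sum_i \sum_j expR (s 0 i) * O i j ^+ 2.
  rewrite -[T]mulmx1 -[T in LHS]mul1mx -trmx1 trl ?trmx1 O1.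
  by apply: eq_bigr => i _; apply: eq_bigr => j _; rewrite expr2.
have trA : \tr A = \sum_i \sum_j expR (e 0 j) * O i j ^+ 2.
  rewrite -[A]mulmx1 -[A in LHS]mul1mx -trmx1 trr ?trmx1 O1.
  by apply: eq_bigr => i _; apply: eq_bigr => j _; rewrite expr2.
have trTS : \tr (T *m sdiag U s) = \sum_i \sum_j expR (s 0 i) * s 0 i * O i j ^+ 2.
  rewrite TE sdiagM // -[sdiag _ _]mulmx1 -[sdiag _ _ in LHS]mul1mx -trmx1.
  rewrite (mxtrace_midl _ _ _ Uo Vo) sdiagK // sum_diag_mx trmx1 O1.
  by apply: eq_bigr => i _; apply: eq_bigr => j _; rewrite !mxE -expr2.
have trTY : \tr (T *m sdiag V e) = \sum_i \sum_j expR (s 0 i) * e 0 j * O i j ^+ 2.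
  rewrite -[T in LHS]mul1mx -trmx1 trl ?trmx1 O1.
  have -> : U *m sdiag V e *m V^T = O *m diag_mx e.
    by rewrite /sdiag -!mulmxA Vo mulmx1 !mulmxA.
  by apply: eq_bigr => i _; apply: eq_bigr => j _; rewrite mul_mx_diag !mxE; ring.
have frm u : u * tangent_form T A (Z u) u = \sum_i \sum_j
    u * (2 * (z u i j * O i j * (expR (e 0 j) - expR (s 0 i)))
     - z u i j ^+ 2 * segm (expR (s 0 i)) (expR (e 0 j)) u).
  have -> : tangent_form T A (Z u) u =
      2 * (\tr (1%:M *m A *m (Z u)^T) - \tr ((Z u)^T *m T *m 1%:M))
      - (1 - u) * \tr ((Z u)^T *m T *m Z u) - u * \tr (Z u *m A *m (Z u)^T).
    by rewrite /tangent_form mulmxBr linearB /= mul1mx mulmx1 (mxtrace_mulC A).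
  rewrite !trr !trl O1.
  rewrite -sumrB 3!mulr_sumr -!sumrB mulr_sumr; apply: eq_bigr => i _.
  rewrite -sumrB !mulr_sumr -!sumrB mulr_sumr; apply: eq_bigr => j _.
  by rewrite /segm -/(z u); ring.
rewrite (eq_riemann_avg (fun u _ => frm u)) riemann_avg_sum.
under eq_bigr do rewrite riemann_avg_sum.
rewrite mulmxBr linearB /= trT trA trTS trTY -!sumrB -big_split /=.
apply: ler_sum => i _; rewrite -!sumrB -big_split /=; apply: ler_sum => j _.
by rewrite -mulrBl -mulrBl -mulrBr; exact: entropy_scalar_ge.
Qed.

End Entropy.

(** * Lieb's three-matrix inequality *)

Section LiebTangent.
Variables (R : realType) (n : nat).
Implicit Types (T A W X Y Z : 'M[R]_n).
Variables (P G : 'M[R]_n) (k b : 'rV[R]_n).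
Hypotheses (Po : P *m P^T = 1%:M) (Go : G *m G^T = 1%:M).

Let w i := expR (k 0 i).
Let al j := expR (b 0 j).
Let s := P *m G^T.
Let w0 i : 0 < w i. Proof. exact: expR_gt0. Qed.
Let al0 j : 0 < al j. Proof. exact: expR_gt0. Qed.

(** [coefT] and [coefA] are the coefficients of [T] and of [A], the latter up to sign, in [\tr T -
    \tr A + u * tangent_form T A (Zmx u) u] read in the bases [P] and [G]. *)
Let coefT i l j (u : R) :=
  w i * al j * (segm (w i) (al j) u * segm (w l) (al j) u)^-1
  - (al j - w l) / segm (w l) (al j) u.

Let coefA i j l (u : R) :=
  w i ^+ 2 * (segm (w i) (al j) u * segm (w i) (al l) u)^-1.

Let zmx u : 'M[R]_n :=
  \matrix_(i, j) (s i j * ((al j - w i) / segm (w i) (al j) u)).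

(* The maximizer of [tangent_form W A0 Z u], where [W] has eigenvectors [P]
   and eigenvalues [w], and [A0] has eigenvectors [G] and eigenvalues [al]. *)
Let Zmx u := P^T *m zmx u *m G.

Let ZmxE u : P *m Zmx u *m G^T = zmx u.
Proof. by rewrite /Zmx !mulmxA Po mul1mx -mulmxA Go mulmx1. Qed.

Let oneE : P *m 1%:M *m G^T = s. Proof. by rewrite mulmx1. Qed.

(** With [m = segm w al u] and [z = (al - w) / m], the identities [1 - u z = w / m] and
    [1 + (1 - u) z = al / m] produce [coefT]. *)
Let tangentT T u : 0 <= u < 1 ->
  \tr (1%:M^T *m T *m 1%:M) - u * \tr ((Zmx u)^T *m T *m 1%:M)
  - u * \tr (1%:M^T *m T *m Zmx u)
  - u * (1 - u) * \tr ((Zmx u)^T *m T *m Zmx u) =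
  \sum_i \sum_l \sum_j (P *m T *m P^T) i l * (s i j * s l j) * coefT i l j u.
Proof.
move=> /andP[u0 u1]; rewrite !(mxtrace_midl _ _ _ Po Go) !ZmxE !oneE.
rewrite !mulr_sumr -!sumrB; apply: eq_bigr => i _.
rewrite !mulr_sumr -!sumrB; apply: eq_bigr => l _.
rewrite !mulr_sumr -!sumrB; apply: eq_bigr => j _.
rewrite !mxE /coefT.
have m1 : 0 < segm (w i) (al j) u by apply: segm_gt0; rewrite // u0 ltW.
have m2 : 0 < segm (w l) (al j) u by apply: segm_gt0; rewrite // u0 ltW.
by move: m1 m2; rewrite /segm => m1 m2; field; rewrite !gt_eqF.
Qed.

(** The scalar coefficient factors as [(1 - u z) (1 - u z')], and each factor is [w / m] for its own
    [m]. *)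
Let tangentA A u : 0 <= u < 1 ->
  \tr (1%:M *m A *m 1%:M^T) - u * \tr (1%:M *m A *m (Zmx u)^T)
  - u * \tr (Zmx u *m A *m 1%:M^T) + u ^+ 2 * \tr (Zmx u *m A *m (Zmx u)^T) =
  \sum_j \sum_l \sum_i (G *m A *m G^T) j l * (s i j * s i l) * coefA i j l u.
Proof.
move=> /andP[u0 u1]; rewrite !(mxtrace_midr _ _ _ Po Go) !ZmxE !oneE.
rewrite !mulr_sumr -!sumrB -big_split; apply: eq_bigr => j _ /=.
rewrite !mulr_sumr -!sumrB -big_split; apply: eq_bigr => l _ /=.
rewrite !mulr_sumr -!sumrB -big_split; apply: eq_bigr => i _ /=.
rewrite !mxE /coefA.
have m1 : 0 < segm (w i) (al j) u by apply: segm_gt0; rewrite // u0 ltW.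
have m2 : 0 < segm (w i) (al l) u by apply: segm_gt0; rewrite // u0 ltW.
by move: m1 m2; rewrite /segm => m1 m2; field; rewrite !gt_eqF.
Qed.

Lemma sum3_riemann_cvg (c : 'I_n -> 'I_n -> 'I_n -> R)
    (f : 'I_n -> 'I_n -> 'I_n -> R -> R) (L : 'I_n -> 'I_n -> 'I_n -> R) :
  (forall i j l, riemann_avg (f i j l) N @[N --> \oo] --> L i j l) ->
  riemann_avg (fun u => \sum_i \sum_j \sum_l c i j l * f i j l u) N
    @[N --> \oo] --> \sum_i \sum_j \sum_l c i j l * L i j l.
Proof.
move=> fL; under eq_fun do rewrite riemann_avg_sum.
apply: cvg_sumr => i; under eq_fun do rewrite riemann_avg_sum.
apply: cvg_sumr => j; under eq_fun do rewrite riemann_avg_sum.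
apply: cvg_sumr => l; under eq_fun do rewrite riemann_avgZ.
exact: cvgM (cvg_cst _) (fL _ _ _).
Qed.

Let coefT_cvg i l j : riemann_avg (coefT i l j) N @[N --> \oo] -->
  w i * ln_quot (w l) (w i) - (b 0 j - k 0 l).
Proof.
rewrite /coefT; under eq_fun do rewrite riemann_avgB riemann_avgZ.
apply: cvgB; last first.
  by rewrite -[b 0 j]expRK -[k 0 l]expRK; exact: ln_sub_cvg.
have -> : w i * ln_quot (w l) (w i) =
    w i * al j * ln_quot (al j * w l) (w i * al j).
  rewrite [X in _ = _ * ln_quot _ X]mulrC ln_quotM //.
  by rewrite -!mulrA mulVKf // gt_eqF.
exact: cvgM (cvg_cst _) (inv_segmM_cvg _ _ _ _).
Qed.

Let coefA_cvg i j l : riemann_avg (coefA i j l) N @[N --> \oo] -->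
  w i * ln_quot (al j) (al l).
Proof.
rewrite /coefA; under eq_fun do rewrite riemann_avgZ.
have -> : w i * ln_quot (al j) (al l) =
    w i ^+ 2 * ln_quot (al j * w i) (w i * al l).
  rewrite [al j * w i]mulrC ln_quotM // expr2 -!mulrA mulVKf ?gt_eqF //.
exact: cvgM (cvg_cst _) (inv_segmM_cvg _ _ _ _).
Qed.

(** The derivative of the logarithm at [sdiag G (map_mx expR b)], applied to
    [sdiag P (map_mx expR k)]: in the basis [G], an entrywise product with the divided differences
    of [ln]. *)
Definition lieb_spec : 'M[R]_n := G^T *m \matrix_(j, l)
  (ln_quot (al j) (al l) * (G *m sdiag P (map_mx expR k) *m G^T) j l) *m G.

Let limT T :
  \sum_i \sum_l \sum_j (P *m T *m P^T) i l * (s i j * s l j) *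
     (w i * ln_quot (w l) (w i) - (b 0 j - k 0 l)) =
  \tr T + \tr (T *m sdiag P k) - \tr (T *m sdiag G b).
Proof.
have -> : \tr (T *m sdiag G b) =
    \sum_i \sum_l \sum_j (P *m T *m P^T) i l * (s i j * s l j) * b 0 j.
  rewrite -[T in LHS]mul1mx -trmx1 (mxtrace_midl _ _ _ Po Go) oneE.
  have -> : P *m sdiag G b *m G^T = s *m diag_mx b.
    by rewrite /sdiag -!mulmxA Go mulmx1 !mulmxA.
  apply: eq_bigr => i _; apply: eq_bigr => l _; apply: eq_bigr => j _.
  by rewrite mul_mx_diag mxE; ring.
have -> : \tr (T *m sdiag P k) = \sum_i (P *m T *m P^T) i i * k 0 i.
  rewrite -(mxtrace_conj _ Po) /sdiag !mulmxA -mulmxA Po mulmx1.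
  by rewrite mul_mx_diag; apply: eq_bigr => i _; rewrite mxE.
have -> : \tr T = \sum_i (P *m T *m P^T) i i by rewrite -(mxtrace_conj _ Po).
rewrite -big_split -sumrB; apply: eq_bigr => i _ /=.
(* The diagonal entry is spread over [l] with a Kronecker delta, which the orthogonality of the rows
   of [s] then replaces. At [l = i] the factor [w i * ln_quot (w i) (w i)] is 1. *)
rewrite -[X in _ = X - _](_ : \sum_l (P *m T *m P^T) i l * (i == l)%:R *
   (w i * ln_quot (w l) (w i) + k 0 l) = _); last first.
  rewrite (bigD1 i) //= eqxx big1 ?addr0 => [|l li].
    by rewrite mulr1 ln_quotxx divff ?gt_eqF // mulrDr mulr1.
  by rewrite eq_sym (negPf li) mulr0 mul0r.
rewrite -sumrB; apply: eq_bigr => l _.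
rewrite -(row_orthogonal i l Po Go) -/s mulr_sumr mulr_suml -sumrB.
by apply: eq_bigr => j _; ring.
Qed.

Let limA A :
  \sum_j \sum_l \sum_i (G *m A *m G^T) j l * (s i j * s i l) *
     (w i * ln_quot (al j) (al l)) = \tr (lieb_spec *m A).
Proof.
have -> : \tr (lieb_spec *m A) = \sum_j \sum_l (G *m A *m G^T) j l *
  (ln_quot (al l) (al j) * (G *m sdiag P (map_mx expR k) *m G^T) l j).
  rewrite /lieb_spec mxtrace_mulC !mulmxA mxtrace_mulC !mulmxA mxtrace_mulE.
  by apply: eq_bigr => j _; apply: eq_bigr => l _; rewrite [X in _ * X = _]mxE.
apply: eq_bigr => j _; apply: eq_bigr => l _.
have -> : (G *m sdiag P (map_mx expR k) *m G^T) l j =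
    \sum_i w i * (s i j * s i l).
  have -> : G *m sdiag P (map_mx expR k) *m G^T = s^T *m diag_mx (map_mx expR k) *m s.
    by rewrite /s /sdiag trmx_mul trmxK !mulmxA.
  rewrite mul_mx_diag mxE; apply: eq_bigr => i _.
  rewrite [X in X * _]mxE [s^T l i]mxE [map_mx _ _ 0 i]mxE -/(w i).
  by ring.
rewrite !mulr_sumr; apply: eq_bigr => i _.
have -> : ln_quot (al l) (al j) = ln_quot (al j) (al l).
  rewrite /ln_quot eq_sym; have [->//|jl] := eqVneq.
  by rewrite -[RHS]mulrNN -invrN !opprB.
by ring.
Qed.

(** [entropy_ge] is tested with the matrices [Zmx u] attached to [(P, k)] and [(G, b)]. In the limit
    both sides contain the trace of [T] against the common difference of exponents, which
    cancels. *)
Theorem lieb_triple U V (sg et : 'rV[R]_n) :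
  U *m U^T = 1%:M -> V *m V^T = 1%:M ->
  sdiag U sg - sdiag V et = sdiag P k - sdiag G b ->
  \tr (sdiag U (map_mx expR sg)) <= \tr (lieb_spec *m sdiag V (map_mx expR et)).
Proof.
move=> Uo Vo SY.
have [T TE] : {T | T = sdiag U (map_mx expR sg)} by eexists.
have [A AE] : {A | A = sdiag V (map_mx expR et)} by eexists.
have As : A^T = A by rewrite AE sdiag_sym.
have Ts : T^T = T by rewrite TE sdiag_sym.
pose avgT := riemann_avg (fun u => \sum_i \sum_l \sum_j
  (P *m T *m P^T) i l * (s i j * s l j) * coefT i l j u).
pose avgA := riemann_avg (fun u => \sum_j \sum_l \sum_i
  (G *m A *m G^T) j l * (s i j * s i l) * coefA i j l u).
have avgE N : \tr T - \tr A + riemann_avg (fun u => u * tangent_form T A (Zmx u) u) N =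
    avgT N - avgA N.
  rewrite -[X in X + _](riemann_avg_cst _ N) -riemann_avgD.
  rewrite /avgT /avgA -riemann_avgB.
  apply: eq_riemann_avg => u u01; rewrite -tangentT // -tangentA //.
  have -> : \tr (Zmx u *m A *m 1%:M^T) = \tr (1%:M *m A *m (Zmx u)^T).
    by rewrite trmx1 mulmx1 mul1mx -mxtrace_tr trmx_mul As.
  have -> : \tr (1%:M^T *m T *m Zmx u) = \tr ((Zmx u)^T *m T *m 1%:M).
    by rewrite trmx1 mulmx1 mul1mx -mxtrace_tr trmx_mul Ts.
  rewrite !trmx1 !mul1mx !mulmx1 (mxtrace_mulC A) /tangent_form mulmxBr linearB /=.
  by ring.
have ineq := entropy_ge Zmx _ Uo Vo TE AE.
have L1 := sum3_riemann_cvg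
  (c := fun i l j => (P *m T *m P^T) i l * (s i j * s l j)) coefT_cvg.
have L2 := sum3_riemann_cvg
  (c := fun j l i => (G *m A *m G^T) j l * (s i j * s i l))
  (f := fun j l i => coefA i j l) (L := fun j l i => w i * ln_quot (al j) (al l))
  (fun j l i => @coefA_cvg i j l).
have h : \forall N \near \oo, avgT N - avgA N <=
    \tr (T *m sdiag P k) - \tr (T *m sdiag G b).
  by near=> N; rewrite -avgE; have := ineq N; rewrite SY mulmxBr linearB.
have := ler_cvg_to (cvgB L1 L2) (cvg_cst _) h.
by rewrite limT limA -TE -AE => /(_ _ _ _); lra.
Unshelve. all: by end_near. Qed.

End LiebTangent.

(** * The resolvent integral and the one-step trace inequality *)

Section LiebMatrix.
Variables (R : realType) (n : nat).
Implicit Types (A B C D K W X Y : 'M[R]_n).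

Definition resolvent A u := invmx ((1 - u)%:M + u *: A).

(** Only inverses, products and sums occur here, so measurability and positivity can be checked on
    these sums, with no choice of eigenvectors. *)
Definition lieb_approx W A (N : nat) : 'M[R]_n := N.+1%:R^-1 *:
  \sum_(k < N.+1) resolvent A (k%:R / N.+1%:R) *m W *m resolvent A (k%:R / N.+1%:R).

(* The adjoint of the derivative of the logarithm at [A], applied to [W]:
   [\int_0^1 ((1 - u) + u A)^-1 W ((1 - u) + u A)^-1 du]. *)
Definition lieb_mx W A : 'M[R]_n := limn (lieb_approx W A).

Lemma lieb_approxE W A N i j : lieb_approx W A N i j =
  riemann_avg (fun u => (resolvent A u *m W *m resolvent A u) i j) N.
Proof. by rewrite mxE summxE. Qed.

Lemma invmx_uniq X Y : X *m Y = 1%:M -> invmx X = Y.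
Proof.
by move=> XY; have [uX _] := mulmx1_unit XY; rewrite -[Y](mulKmx uX) XY mulmx1.
Qed.

Lemma resolvent_sdiag G (b : 'rV[R]_n) u : G *m G^T = 1%:M -> 0 <= u < 1 ->
  resolvent (sdiag G (map_mx expR b)) u =
  sdiag G (\row_j (segm 1 (expR (b 0 j)) u)^-1).
Proof.
move=> Go /andP[u0 u1]; apply: invmx_uniq.
rewrite -(sdiag_const (1 - u) Go) -sdiagZ -sdiagD sdiagM // -(sdiag_const 1 Go).
congr sdiag; apply/rowP => j; rewrite !mxE /segm mulr1 divff // gt_eqF //.
rewrite -[1 - u]mulr1; apply: (segm_gt0 ltr01 (expR_gt0 _)).
by rewrite u0 ltW.
Qed.

Lemma mulmx_conjE (G M : 'M[R]_n) i j :
  (G^T *m M *m G) i j = \sum_l \sum_m G l i * G m j * M l m.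
Proof.
rewrite mxE exchange_big /=; apply: eq_bigr => m _.
rewrite mxE mulr_suml; apply: eq_bigr => l _; rewrite mxE.
by ring.
Qed.

Lemma lieb_approx_cvg P G (k b : 'rV[R]_n) :
  P *m P^T = 1%:M -> G *m G^T = 1%:M -> forall i j,
  lieb_approx (sdiag P (map_mx expR k)) (sdiag G (map_mx expR b)) N i j
    @[N --> \oo] --> lieb_spec P G k b i j.
Proof.
move=> Po Go i j; under eq_fun do rewrite lieb_approxE.
set W := sdiag P _; pose W' := G *m W *m G^T.
rewrite /lieb_spec -/W mulmx_conjE.
rewrite (_ : (fun N => _) = fun N => \sum_l \sum_m G l i * G m j *
   (W' l m * riemann_avg (fun u => (segm 1 (expR (b 0 l)) u * segm 1 (expR (b 0 m)) u)^-1) N)).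
  apply: cvg_sumr => l; apply: cvg_sumr => m; apply: cvgM (cvg_cst _) _.
  rewrite [X in _ --> X]mxE [X in _ --> X]mulrC; apply: cvgM (cvg_cst _) _.
  (* Both segments start at 1; the factors 1 give the arguments of [ln_quot] the shape [y * x'] and
     [x * y']. *)
  rewrite -[expR (b 0 l)]mulr1 -[X in ln_quot _ X]mul1r.
  by rewrite [X in segm 1 X]mulr1; apply: inv_segmM_cvg => //; exact: expR_gt0.
apply/funext => N.
under [RHS]eq_bigr do under eq_bigr do rewrite -!riemann_avgZ.
under [RHS]eq_bigr do rewrite -riemann_avg_sum.
rewrite -riemann_avg_sum; apply: eq_riemann_avg => u u01.
rewrite resolvent_sdiag //.
set c := \row_j _.
have -> : sdiag G c *m W *m sdiag G c =
    G^T *m (diag_mx c *m W' *m diag_mx c) *m G by rewrite /sdiag /W' !mulmxA.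
rewrite mulmx_conjE; apply: eq_bigr => l _; apply: eq_bigr => m _.
by congr (_ * _); rewrite mul_diag_mx mul_mx_diag mxE [X in X * _]mxE !mxE invfM; ring.
Qed.

(** Joins the spectral form, in which Lieb's inequality is proved, to the integral form. *)
Lemma lieb_mx_sdiag P G (k b : 'rV[R]_n) :
  P *m P^T = 1%:M -> G *m G^T = 1%:M ->
  lieb_mx (sdiag P (map_mx expR k)) (sdiag G (map_mx expR b)) = lieb_spec P G k b.
Proof. by move=> Po Go; apply: mx_lim; exact: lieb_approx_cvg. Qed.

Lemma lieb_mx_cvg K B : K^T = K -> B^T = B -> forall i j,
  lieb_approx (expmx K) (expmx B) N i j @[N --> \oo] -->
  lieb_mx (expmx K) (expmx B) i j.
Proof.
move=> /symmetric_spectral [P [k Po ->]] /symmetric_spectral [G [b Go ->]] i j.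
rewrite -/(sdiag P k) -/(sdiag G b) !expmx_sdiag // lieb_mx_sdiag //.
exact: lieb_approx_cvg.
Qed.

Lemma quad_formE C (x : 'rV[R]_n) :
  (x *m C *m x^T) 0 0 = \sum_i \sum_j x 0 i * x 0 j * C i j.
Proof.
rewrite mxE exchange_big /=; apply: eq_bigr => j _.
by rewrite mxE mulr_suml; apply: eq_bigr => i _; rewrite mxE mulrAC.
Qed.

Lemma expmx_psd K (x : 'rV[R]_n) : K^T = K -> 0 <= (x *m expmx K *m x^T) 0 0.
Proof.
move=> /symmetric_spectral [P [k Po ->]]; rewrite -/(sdiag P k) expmx_sdiag //.
rewrite quad_sdiag; apply: sumr_ge0 => i _.
by rewrite mxE mulr_ge0 ?expR_ge0 ?sqr_ge0.
Qed.

(** Each term of the Riemann sum is a congruence of [expmx K] by a symmetric resolvent, and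
    nonnegativity passes to the limit. *)
Lemma lieb_mx_psd K B (x : 'rV[R]_n) : K^T = K -> B^T = B ->
  0 <= (x *m lieb_mx (expmx K) (expmx B) *m x^T) 0 0.
Proof.
move=> Ks Bs.
have L : \sum_i \sum_j x 0 i * x 0 j * lieb_approx (expmx K) (expmx B) N i j
    @[N --> \oo] --> (x *m lieb_mx (expmx K) (expmx B) *m x^T) 0 0.
  rewrite quad_formE; apply: cvg_sumr => i; apply: cvg_sumr => j.
  by apply: cvgM (cvg_cst _) _; exact: lieb_mx_cvg.
apply: (ler_cvg_to (cvg_cst 0) L); near=> N.
rewrite -quad_formE /lieb_approx -scalemxAr -scalemxAl mxE.
rewrite mulr_ge0 ?invr_ge0 // mulmx_sumr mulmx_suml summxE.
apply: sumr_ge0 => k _; move: (k%:R / N.+1%:R) => u.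
have rs : (resolvent (expmx B) u)^T = resolvent (expmx B) u.
  by rewrite trmx_inv linearD linearZ /= tr_scalar_mx expmx_sym.
have -> : x *m (resolvent (expmx B) u *m expmx K *m resolvent (expmx B) u) *m x^T =
    x *m resolvent (expmx B) u *m expmx K *m (x *m resolvent (expmx B) u)^T.
  by rewrite trmx_mul rs !mulmxA.
exact: expmx_psd.
Unshelve. all: by end_near. Qed.

Lemma lieb_mx_pos K B V (m : 'rV[R]_n) : K^T = K -> B^T = B ->
  (forall j, 0 <= m 0 j) ->
  0 <= \tr (lieb_mx (expmx K) (expmx B) *m sdiag V m).
Proof.
move=> Ks Bs m0; set C := lieb_mx _ _.
rewrite /sdiag !mulmxA mxtrace_mulC !mulmxA mul_mx_diag.
apply: sumr_ge0 => j _; rewrite mxE mulr_ge0 //.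
have -> : (V *m C *m V^T) j j = (row j V *m C *m (row j V)^T) 0 0.
  rewrite tr_row -row_mul mxE [RHS]mxE; apply: eq_bigr => i _.
  by congr (_ * _); rewrite [RHS]mxE.
exact: lieb_mx_psd.
Qed.

(** In the eigenbasis of [B] the trace involves only diagonal entries, where [ln_quot] is an inverse
    eigenvalue of [expmx B] and cancels it. *)
Lemma mxtrace_lieb_mx K B : K^T = K -> B^T = B ->
  \tr (lieb_mx (expmx K) (expmx B) *m expmx B) = \tr (expmx K).
Proof.
move=> /symmetric_spectral [P [k Po ->]] /symmetric_spectral [G [b Go ->]].
rewrite -/(sdiag P k) -/(sdiag G b) !expmx_sdiag // lieb_mx_sdiag //.
rewrite /lieb_spec {2}/sdiag !mulmxA -[_ *m G *m G^T]mulmxA Go mulmx1.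
rewrite mxtrace_mulC !mulmxA Go mul1mx mul_mx_diag.
rewrite -[RHS](mxtrace_conj _ Go); apply: eq_bigr => j _.
rewrite mxE [X in X * _]mxE ln_quotxx [map_mx _ _ _ _]mxE mulrAC mulVf.
  by rewrite mul1r /sdiag !mulmxA.
by rewrite gt_eqF ?expR_gt0.
Qed.

(** Lieb's inequality comes first, with the second exponent diagonal in the eigenbasis of [D]. Fan's
    scalar inequality on each eigenvalue and the positivity of [lieb_mx] then replace its
    exponential by [1 + g D]. *)
Theorem mxtrace_expmx_step K B D g : K^T = K -> B^T = B -> D^T = D ->
  0 < g < 1 -> -1 <= lambda_min D ->
  \tr (expmx (K - B + (g *: D - psiE g *: D ^+ 2))) <=
  \tr (lieb_mx (expmx K) (expmx B) *m (1%:M + g *: D)).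
Proof.
move=> Ks Bs /symmetric_spectral [V [x Vo ->]] g01; rewrite -/(sdiag V x) => x1.
have x_ge j : -1 <= x 0 j := le_trans x1 (lambda_min_le _ _ Vo).
pose y : 'rV[R]_n := \row_j (g * x 0 j - psiE g * x 0 j ^+ 2).
have -> : g *: sdiag V x - psiE g *: sdiag V x ^+ 2 = sdiag V y.
  rewrite sdiag_exp // -!sdiagZ -sdiagB; congr sdiag.
  by apply/rowP => j; rewrite !mxE.
have yE : 1%:M + g *: sdiag V x - sdiag V (map_mx expR y) =
    sdiag V (\row_j (1 + g * x 0 j - expR (y 0 j))).
  rewrite -(sdiag_const 1 Vo) -sdiagZ -sdiagD -sdiagB; congr sdiag.
  by apply/rowP => j; rewrite !mxE.
apply: (@le_trans _ _ (\tr (lieb_mx (expmx K) (expmx B) *m sdiag V (map_mx expR y)))).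
  have Ss : (K - B + sdiag V y)^T = K - B + sdiag V y.
    by rewrite linearD linearB /= Ks Bs sdiag_sym.
  move: Ks Bs Ss => /symmetric_spectral [P [k Po ->]] /symmetric_spectral [G [b Go ->]].
  move=> /symmetric_spectral [U [s Uo E]].
  rewrite E -/(sdiag P k) -/(sdiag G b) -/(sdiag U s) !expmx_sdiag // lieb_mx_sdiag //.
  by apply: lieb_triple => //; rewrite -[sdiag U s]E addrK.
rewrite -subr_ge0 -linearB -mulmxBr yE; apply: lieb_mx_pos => // j.
rewrite mxE subr_ge0 mxE; exact: fan_expR.
Qed.

Lemma mxtrace_lieb_mx_le K B : K^T = K -> B^T = B ->
  \tr (lieb_mx (expmx K) (expmx B) *m (1%:M + B)) <= \tr (expmx K).
Proof.
move=> Ks Bs; rewrite -(mxtrace_lieb_mx Ks Bs) -subr_ge0 -linearB -mulmxBr.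
have /symmetric_spectral [G [b Go BE]] := Bs.
have -> : expmx B - (1%:M + B) = sdiag G (\row_j (expR (b 0 j) - (1 + b 0 j))).
  rewrite BE -/(sdiag G b) expmx_sdiag // -(sdiag_const 1 Go) -sdiagD -sdiagB.
  by congr sdiag; apply/rowP => j; rewrite !mxE.
by apply: lieb_mx_pos => // j; rewrite mxE subr_ge0 expR_ge1Dx.
Qed.

End LiebMatrix.

(** * Measurability *)

Section MatrixMeasurability.
Context {d : measure_display} {T : measurableType d} {R : realType}.
Implicit Types (f g : T -> R).

Lemma measurable_sumr (I : Type) (r : seq I) (h : I -> T -> R) :
  (forall i, measurable_fun setT (h i)) ->
  measurable_fun setT (fun w => \sum_(i <- r) h i w).
Proof.
move=> mh; elim: r => [|i r IH].
  by under eq_fun do rewrite big_nil; exact: measurable_cst.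
by under eq_fun do rewrite big_cons; exact: measurable_funD.
Qed.

Lemma measurable_prodr (I : Type) (r : seq I) (h : I -> T -> R) :
  (forall i, measurable_fun setT (h i)) ->
  measurable_fun setT (fun w => \prod_(i <- r) h i w).
Proof.
move=> mh; elim: r => [|i r IH].
  by under eq_fun do rewrite big_nil; exact: measurable_cst.
by under eq_fun do rewrite big_cons; exact: measurable_funM.
Qed.

Lemma measurable_funV f : measurable_fun setT f -> (forall w, 0 < f w) ->
  measurable_fun setT (fun w => (f w)^-1).
Proof.
move=> mf f0; rewrite (_ : (fun w => _) = fun w => expR (- ln (f w))).
  apply: (measurableT_comp (@measurable_expR R)); apply: measurable_funN.
  exact: (measurableT_comp (@measurable_ln R)).
by apply/funext => w; rewrite expRN lnK // posrE.
Qed.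

Definition measurable_mx m n (A : T -> 'M[R]_(m, n)) :=
  forall i j, measurable_fun setT (fun w => A w i j).

Lemma eq_measurable_mx m n (A B : T -> 'M[R]_(m, n)) :
  A =1 B -> measurable_mx A -> measurable_mx B.
Proof. by move=> /funext ->. Qed.

Lemma measurable_mx_cst m n (A : 'M[R]_(m, n)) : measurable_mx (fun=> A).
Proof. by move=> i j; exact: measurable_cst. Qed.

Lemma measurable_mxD m n (A B : T -> 'M[R]_(m, n)) :
  measurable_mx A -> measurable_mx B -> measurable_mx (fun w => A w + B w).
Proof.
by move=> mA mB i j; under eq_fun do rewrite mxE; exact: measurable_funD.
Qed.

Lemma measurable_mxB m n (A B : T -> 'M[R]_(m, n)) :
  measurable_mx A -> measurable_mx B -> measurable_mx (fun w => A w - B w).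
Proof.
by move=> mA mB i j; under eq_fun do rewrite !mxE; exact: measurable_funB.
Qed.

Lemma measurable_mxZ m n f (A : T -> 'M[R]_(m, n)) :
  measurable_fun setT f -> measurable_mx A -> measurable_mx (fun w => f w *: A w).
Proof.
by move=> mf mA i j; under eq_fun do rewrite mxE; exact: measurable_funM.
Qed.

Lemma measurable_mxM m n p (A : T -> 'M[R]_(m, n)) (B : T -> 'M[R]_(n, p)) :
  measurable_mx A -> measurable_mx B -> measurable_mx (fun w => A w *m B w).
Proof.
move=> mA mB i j; under eq_fun do rewrite mxE.
by apply: measurable_sumr => k; exact: measurable_funM.
Qed.

Lemma measurable_mx_sum m n (I : Type) (r : seq I) (A : I -> T -> 'M[R]_(m, n)) :
  (forall i, measurable_mx (A i)) ->
  measurable_mx (fun w => \sum_(i <- r) A i w).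
Proof.
move=> mA i j; under eq_fun do rewrite summxE.
by apply: measurable_sumr => k; exact: mA.
Qed.

Lemma measurable_mxtrace n (A : T -> 'M[R]_n) :
  measurable_mx A -> measurable_fun setT (fun w => \tr (A w)).
Proof. by move=> mA; apply: measurable_sumr => i; exact: mA. Qed.

Lemma measurable_det n (A : T -> 'M[R]_n) :
  measurable_mx A -> measurable_fun setT (fun w => \det (A w)).
Proof.
move=> mA; apply: measurable_sumr => s; apply: measurable_funM.
  exact: measurable_cst.
by apply: measurable_prodr => i; exact: mA.
Qed.

(** Cramer's rule: the adjugate and the determinant are polynomial in the entries. *)
Lemma measurable_invmx n (A : T -> 'M[R]_n) : measurable_mx A ->
  (forall w, 0 < \det (A w)) -> measurable_mx (fun w => invmx (A w)).
Proof.
move=> mA A0; apply: (@eq_measurable_mx _ _ (fun w => (\det (A w))^-1 *: \adj (A w))).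
  by move=> w; rewrite /invmx unitmxE unitfE gt_eqF //.
apply: measurable_mxZ; first exact: measurable_funV (measurable_det mA) A0.
move=> i j; under eq_fun do rewrite mxE.
apply: measurable_funM; first exact: measurable_cst.
apply: measurable_det => k l; under eq_fun do rewrite !mxE; exact: mA.
Qed.

Lemma measurable_mxX n (A : T -> 'M[R]_n) k :
  measurable_mx A -> measurable_mx (fun w => A w ^+ k).
Proof.
move=> mA; elim: k => [|k IH].
  by apply: (@eq_measurable_mx _ _ (fun=> 1%:M)) => //; exact: measurable_mx_cst.
by under eq_fun do rewrite exprS; exact: measurable_mxM.
Qed.

Lemma measurable_expmx n (A : T -> 'M[R]_n) : (forall w, (A w)^T = A w) ->
  measurable_mx A -> measurable_mx (fun w => expmx (A w)).
Proof.
move=> As mA i j.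
apply: (measurable_fun_cvg (h := fun N w =>
  series (fun k : nat => (k`!%:R)^-1 *: A w ^+ k) N i j)); last first.
  by move=> w _; exact: expmx_cvg.
move=> N; rewrite /series /=; apply: measurable_mx_sum => k.
by apply: measurable_mxZ; [exact: measurable_cst|exact: measurable_mxX].
Qed.

Lemma det_sdiag n (G : 'M[R]_n) (c : 'rV[R]_n) : G *m G^T = 1%:M ->
  \det (sdiag G c) = \prod_j c 0 j.
Proof.
move=> Go; rewrite /sdiag !det_mulmx det_diag mulrAC -det_mulmx.
by rewrite orthogonalC // det1 mul1r.
Qed.

Lemma measurable_lieb_mx n (K B : T -> 'M[R]_n) :
  (forall w, (K w)^T = K w) -> (forall w, (B w)^T = B w) ->
  measurable_mx K -> measurable_mx B ->
  measurable_mx (fun w => lieb_mx (expmx (K w)) (expmx (B w))).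
Proof.
move=> Ks Bs mK mB i j.
apply: (measurable_fun_cvg (h := fun N w =>
  lieb_approx (expmx (K w)) (expmx (B w)) N i j)); last first.
  by move=> w _; exact: lieb_mx_cvg.
move=> N; apply: measurable_mxZ; first exact: measurable_cst.
apply: measurable_mx_sum => k; have [u0 u1] := riemann_point R k.
move: (k%:R / N.+1%:R) u0 u1 => u u0 u1.
have mr : measurable_mx (fun w => resolvent (expmx (B w)) u).
  apply: measurable_invmx.
    apply: measurable_mxD; first exact: measurable_mx_cst.
    by apply: measurable_mxZ; [exact: measurable_cst|exact: measurable_expmx].
  (* The determinant is the product of the numbers [(1 - u) + u * expR (b 0 l)], positive because
     nodes satisfy [u < 1]. *)
  move=> w; have [G [b Go ->]] := symmetric_spectral (Bs w).
  rewrite -/(sdiag G b) expmx_sdiag // -(sdiag_const (1 - u) Go) -sdiagZ -sdiagD.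
  rewrite det_sdiag //; apply: prodr_gt0 => l _; rewrite !mxE.
  by rewrite ltr_wpDr ?mulr_ge0 ?expR_ge0 // subr_gt0.
by do 2?apply: measurable_mxM => //; exact: measurable_expmx.
Qed.

Lemma measurable_lambda_max n (A : T -> 'M[R]_n.+1) : (forall w, (A w)^T = A w) ->
  measurable_mx A -> measurable_fun setT (fun w => lambda_max (A w)).
Proof.
move=> As mA.
apply: (measurable_fun_cvg (h := fun N w =>
  N.+1%:R^-1 * ln (\tr (expmx (N.+1%:R *: A w))))); last first.
  by move=> w _; exact: lambda_max_cvg.
move=> N; apply: measurable_funM; first exact: measurable_cst.
apply: (measurableT_comp (@measurable_ln R)); apply: measurable_mxtrace.
apply: measurable_expmx; first by move=> w; rewrite linearZ /= As.
by apply: measurable_mxZ => //; exact: measurable_cst.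
Qed.

Lemma measurable_psiE f : measurable_fun setT f ->
  measurable_fun setT (fun w => psiE (f w)).
Proof.
move=> mf; apply: measurable_funB => //; apply: measurable_funN.
apply: (measurableT_comp (@measurable_ln R)).
by apply: measurable_funB => //; exact: measurable_cst.
Qed.

End MatrixMeasurability.

(** * Conditional expectations *)

Section SubSigmaAlgebra.
Context {disp : measure_display} {T : measurableType disp} {R : realType}.
Variable P : probability T R.
Variable G : set (set T).
Hypothesis sG : sigma_algebra [set: T] G.
Hypothesis GT : G `<=` @measurable _ T.
Implicit Types (f g h X Y Z : T -> R).

Lemma g_sigma_measurableE :
  (@measurable _ (g_sigma_algebraType G) : set (set T)) = G.
Proof. exact: measurable_g_measurableTypeE. Qed.

Lemma measurable_wrtW f : measurable_wrt G f -> measurable_fun setT f.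
Proof.
move=> mf _ Y mY; apply: GT; rewrite -g_sigma_measurableE.
by apply: mf.
Qed.

Lemma measurable_wrt_preimage f (Y : set R) : measurable_wrt G f ->
  measurable Y -> G (f @^-1` Y).
Proof. by move=> mf mY; rewrite -g_sigma_measurableE -[X in measurable X]setTI; apply: mf. Qed.

Lemma measurable_wrt_indic (A : set T) : G A -> measurable_wrt G (\1_A : T -> R).
Proof.
by move=> GA; apply/measurable_indicP; rewrite g_sigma_measurableE.
Qed.

Lemma measurable_wrt_ge f (c : R) : measurable_wrt G f -> G [set w | c <= f w].
Proof.
move=> mf; have := measurable_wrt_preimage mf (measurable_itv `[c, +oo[).
by rewrite preimage_itvcy.
Qed.

Lemma integrable_boundedM h f k : measurable_fun setT h ->
  (forall w, `|h w| <= k) -> P.-integrable setT (EFin \o f) ->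
  P.-integrable setT (EFin \o (fun w => h w * f w)).
Proof.
move=> mh hk fi.
rewrite (_ : EFin \o _ = (EFin \o h) \* (EFin \o f))%E; last exact/funext.
apply: integrableMr => //; exists k; split; first exact: num_real.
by move=> x kx w _; exact: le_trans (hk w) (ltW kx).
Qed.

Lemma integrable_subr f g : P.-integrable setT (EFin \o f) ->
  P.-integrable setT (EFin \o g) ->
  P.-integrable setT (EFin \o (fun w => f w - g w)).
Proof.
move=> fi gi; have := integrableB measurableT fi gi.
by apply: eq_integrable => // w _.
Qed.

(** The sum is the integer part of [x] written with indicators; it serves to approximate a bounded
    function by indicators of its superlevel sets. *)
Lemma count_le_bounds (x : R) (N : nat) : 0 <= x <= N%:R ->
  x - 1 <= \sum_(j < N) (j.+1%:R <= x)%R%:R <= x.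
Proof.
elim: N => [|N IH] /andP[x0 xN].
  by rewrite big_ord0 x0 andbT; move: xN => /= xN; lra.
rewrite big_ord_recr /=; have [xN'|Nx] := leP x N%:R.
  have := IH; rewrite x0 xN' => /(_ erefl).
  have -> : (N.+1%:R <= x) = false.
    by apply/negbTE; rewrite -ltNge; apply: le_lt_trans xN' _; rewrite ltr_nat.
  by rewrite addr0.
rewrite (eq_bigr (fun=> 1)) => [|j _]; last first.
  by have -> : (j.+1%:R <= x) by apply: le_trans (ltW Nx); rewrite ler_nat.
rewrite sumr_const card_ord; have [Nx'|xN'] := leP N.+1%:R x.
  by move: xN Nx'; rewrite -natr1 /= => xN Nx'; apply/andP; split; lra.
by move: xN'; rewrite -natr1 /= => xN'; apply/andP; split; lra.
Qed.

Section TakingOutKnown.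
Variable Z : T -> R.
Hypothesis Zi : P.-integrable setT (EFin \o Z).
Hypothesis Z0 : forall A, G A -> (\int[P]_(w in A) (Z w)%:E = 0)%E.

Let indic_orth (A : set T) : G A -> (\int[P]_w (\1_A w * Z w)%:E = 0)%E.
Proof.
move=> GA; rewrite -(Z0 GA) [RHS]integral_mkcond.
apply: eq_integral => w _; rewrite patchE indicE.
by case: ifP => _; rewrite ?mul1r ?mul0r.
Qed.

(** [h] is approximated from below, within [1 / m.+1], by a combination [hm] of indicators of sets
    of [G]. Each of these is orthogonal to [Z], so the integral is at most [1 / m.+1] times that of
    [|Z|]. *)
Let nonneg_orth h k : measurable_wrt G h -> (forall w, 0 <= h w <= k%:R) ->
  (\int[P]_w (h w * Z w)%:E = 0)%E.
Proof.
move=> mh hk.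
have hi : P.-integrable setT (EFin \o (fun w => h w * Z w)).
  apply: (@integrable_boundedM _ _ k%:R) => //; first exact: measurable_wrtW.
  by move=> w; have /andP[h0 ?] := hk w; rewrite ger0_norm.
have Zni : P.-integrable setT (EFin \o (fun w => `|Z w|)) by exact: integrable_norm.
suff bound m : `|\int[P]_w (h w * Z w)| <= m.+1%:R^-1 * \int[P]_w `|Z w|.
  have lim0 : m.+1%:R^-1 * \int[P]_w `|Z w| @[m --> \oo] --> (0 : R).
    by rewrite -[X in _ --> X](mul0r (\int[P]_w `|Z w|)); exact: cvgM cvg_harmonic (cvg_cst _).
  have : `|\int[P]_w (h w * Z w)| <= 0.
    by apply: (ler_cvg_to (cvg_cst _) lim0); apply: nearW => m; exact: bound.
  rewrite normr_le0 => /eqP h0; rewrite -[LHS]fineK; first by rewrite -/(Rintegral P _ _) h0.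
  exact: integrable_fin_num.
pose E j := [set w | j.+1%:R <= m.+1%:R * h w].
have GE j : G (E j).
  by apply: measurable_wrt_ge; apply: measurable_funM => //; exact: measurable_cst.
pose hm (w : T) : R := m.+1%:R^-1 * \sum_(j < k * m.+1) \1_(E j) w.
have m0 : 0 < m.+1%:R :> R by rewrite ltr0Sn.
have hmE w : hm w <= h w <= hm w + m.+1%:R^-1.
  have /andP[h0 hk'] := hk w.
  have := @count_le_bounds (m.+1%:R * h w) (k * m.+1).
  rewrite mulr_ge0 // natrM [k%:R * _]mulrC ler_pM2l // hk' => /(_ erefl).
  rewrite (eq_bigr (fun j : 'I__ => \1_(E j) w)) => [|j _]; last first.
    by rewrite indicE /E; congr (_ _)%:R; apply/idP/idP; rewrite inE.
  rewrite /hm; set s := \sum_(_ < _) _ => /andP[lo hi'].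
  rewrite ler_pdivrMl // hi' /= -[X in _ <= _ + X]mulr1 -mulrDr ler_pdivlMl //.
  by lra.
have mE j : measurable_fun setT (\1_(E j) : T -> R).
  by apply: measurable_indic; exact: GT.
have mhm : measurable_fun setT hm.
  by apply: measurable_funM; [exact: measurable_cst|exact: measurable_sumr].
have hmi : P.-integrable setT (EFin \o (fun w => hm w * Z w)).
  apply: (@integrable_boundedM _ _ (k%:R + 1)) => // w.
  have /andP[h1 h2] := hmE w; have /andP[h0 h3] := hk w.
  rewrite ger0_norm; first by rewrite (le_trans h1) // (le_trans h3) // lerDl.
  by rewrite mulr_ge0 ?invr_ge0 // sumr_ge0 // => j _; rewrite indicE.
have hm0 : \int[P]_w (hm w * Z w) = 0.
  rewrite /Rintegral (eq_integral (fun w => (m.+1%:R^-1)%:E *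
     \sum_(j < k * m.+1) (\1_(E j) w * Z w)%:E)%E); last first.
    by move=> w _; rewrite sumEFin -EFinM /hm -mulrA mulr_suml.
  have Ei j : P.-integrable setT (EFin \o (fun w => \1_(E j) w * Z w)).
    apply: (@integrable_boundedM _ _ 1) => // w.
    by rewrite indicE; case: (_ \in _); rewrite /= ?normr1 ?normr0.
  rewrite integralZl //; last by apply: integrable_sum => // j _; exact: Ei.
  rewrite (integral_sum measurableT) => [|j]; last exact: Ei.
  by rewrite big1 ?mule0 // => j _; exact: indic_orth.
have -> : \int[P]_w (h w * Z w) = \int[P]_w ((h w - hm w) * Z w).
  rewrite -[LHS]subr0 -hm0 -RintegralB //.
  by apply: eq_Rintegral => w _; rewrite mulrBl.
have di : P.-integrable setT (EFin \o (fun w => (h w - hm w) * Z w)).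
  have := integrable_subr hi hmi; apply: eq_integrable => // w _ /=.
  by rewrite mulrBl.
apply: le_trans (le_normr_Rintegral _ di) _ => //.
rewrite -RintegralZl //; apply: le_Rintegral => //.
- by have := integrable_norm di.
- have := integrableZl measurableT m.+1%:R^-1 Zni.
  by apply: eq_integrable => // w _ /=; rewrite EFinM.
move=> w _; rewrite normrM; apply: ler_wpM2r => //; have /andP[h1 h2] := hmE w.
by rewrite ger0_norm ?subr_ge0 // lerBlDl.
Qed.

(** Adding [k] makes [h] nonnegative; the added constant integrates to zero against [Z] because the
    whole space belongs to [G]. *)
Lemma taking_out_known h k : measurable_wrt G h -> (forall w, `|h w| <= k%:R) ->
  (\int[P]_w (h w * Z w)%:E = 0)%E.
Proof.
move=> mh hk.
have mk : measurable_wrt G (fun w => h w + k%:R).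
  by apply: measurable_funD => //; exact: measurable_cst.
have := @nonneg_orth (fun w => h w + k%:R) (k + k) mk.
have h_bound w : 0 <= h w + k%:R <= (k + k)%:R.
  by have := hk w; rewrite ler_norml natrD => /andP[h1 h2]; apply/andP; split; lra.
move=> /(_ h_bound).
have ki : P.-integrable setT (EFin \o (fun w => k%:R * Z w)).
  by apply: (@integrable_boundedM _ _ k%:R) => // w; rewrite ger0_norm.
have hi : P.-integrable setT (EFin \o (fun w => h w * Z w)).
  by apply: (@integrable_boundedM _ _ k%:R) => //; exact: measurable_wrtW.
rewrite (eq_integral (fun w => (h w * Z w)%:E + (k%:R * Z w)%:E)%E) => [|w _]; last first.
  by rewrite mulrDl EFinD.
rewrite integralD_EFin //.
rewrite (eq_integral (fun w => (k%:R)%:E * (Z w)%:E)%E (fun w => (k%:R * Z w)%:E)) //.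
by rewrite integralZl // Z0 ?mule0 ?adde0 //; case: sG => s0 sC _; have := sC _ s0; rewrite setD0.
Qed.

End TakingOutKnown.

Lemma cond_expectationM h k X Y : cond_expectation P G X Y ->
  measurable_wrt G h -> (forall w, `|h w| <= k%:R) ->
  (\int[P]_w (h w * X w)%:E = \int[P]_w (h w * Y w)%:E)%E.
Proof.
move=> [Xi mY Yi XY] mh hk; have mh' := measurable_wrtW mh.
have Zi : P.-integrable setT (EFin \o (fun w => X w - Y w)).
  exact: integrable_subr.
have hXi := integrable_boundedM mh' hk Xi.
have hYi := integrable_boundedM mh' hk Yi.
have Z0 A : G A -> (\int[P]_(w in A) (X w - Y w)%:E = 0)%E.
  move=> GA; have mA := GT GA.
  have XAi : P.-integrable A (EFin \o X) by exact: integrableS Xi.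
  have YAi : P.-integrable A (EFin \o Y) by exact: integrableS Yi.
  by rewrite integralB_EFin // XY // subee //; exact: integrable_fin_num.
have := taking_out_known Zi Z0 mh hk.
rewrite (eq_integral (fun w => (h w * X w)%:E - (h w * Y w)%:E)%E) => [|w _]; last first.
  by rewrite mulrBr EFinB.
rewrite integralB_EFin //.
have := integrable_fin_num measurableT hYi; have := integrable_fin_num measurableT hXi.
rewrite /=; move: (integral _ _ _) (integral _ _ _) => [a| |] [b| |] // _ _ [] /subr0_eq.
by move=> ->.
Qed.

End SubSigmaAlgebra.

(** * Existence of conditional expectations and the one-step supermartingale inequality *)

Section ConditionalExpectation.
Context {disp : measure_display} {T : measurableType disp} {R : realType}.
Variable P : probability T R.
Variable G : set (set T).
Hypothesis sG : sigma_algebra [set: T] G.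
Hypothesis GT : G `<=` @measurable _ T.

(* Radon-Nikodym on the measurable space of [G], for the pushforwards of [P]
   and of [A |-> \int_A X dP] under the identity. *)
Lemma cond_expectation_exists (X : T -> R) :
  P.-integrable setT (EFin \o X) -> exists Y, cond_expectation P G X Y.
Proof.
move=> Xi; pose T' := g_sigma_algebraType G.
pose phi : T -> T' := id.
have mphi : measurable_fun setT phi.
  by move=> _ A mA; rewrite setTI; apply: GT; rewrite -(g_sigma_measurableE sG).
pose mphiM := isMeasurableFun.Build _ _ _ _ _ mphi.
pose phiM : {mfun T >-> T'} := HB.pack phi mphiM.
pose mu : {sigma_finite_measure set T' -> \bar R} := distribution P phiM.
have [nu nuE] : exists nu : {charge set T' -> \bar R},
    forall A, nu A = (\int[P]_(w in A) (X w)%:E)%E.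
  by unshelve eexists (pushforward (induced_charge Xi) phi : {charge set T' -> \bar R}).
have numu : nu `<< mu.
  apply/null_content_dominatesP => A mA muA0; rewrite nuE.
  apply: null_set_integral => //.
  - by apply: GT; rewrite -(g_sigma_measurableE sG).
  - by apply: measurable_funTS; exact: measurable_int Xi.
pose Y' := Radon_Nikodym nu mu.
have Y'i : mu.-integrable setT Y' by exact: Radon_Nikodym_integrable.
have Y'fin w : Y' w \is a fin_num by exact: Radon_Nikodym_fin_num.
pose Y : T -> R := fine \o Y'.
have YE w : (Y w)%:E = Y' w by rewrite /Y /= fineK.
have mY' : measurable_fun [set: T'] Y' by exact: measurable_int Y'i.
have mY'T : measurable_fun [set: T] Y'.
  by apply: (measurableT_comp mY' mphi).
have Yi : P.-integrable setT (EFin \o Y).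
  rewrite (_ : EFin \o Y = Y'); last exact/funext.
  apply/integrableP; split => //.
  have /integrableP [_] := Y'i; rewrite ge0_integral_pushforward //.
  exact: measurableT_comp.
exists Y; split => //.
  by apply: measurableT_comp => //; exact: measurable_fine.
move=> A GA; have mA : measurable (A : set T') by rewrite (g_sigma_measurableE sG).
rewrite -nuE (Radon_Nikodym_integral numu mA) integral_pushforward //.
  by apply: eq_integral => w _; rewrite YE.
apply: (@integrableS _ _ _ _ setT) => //.
  exact: GT.
by move: Yi; apply: eq_integrable => // w _; rewrite /= YE.
Qed.

Lemma integrable_sumr (I : Type) (s : seq I) (f : I -> T -> R) :
  (forall i, P.-integrable setT (EFin \o f i)) ->
  P.-integrable setT (EFin \o (fun w => \sum_(i <- s) f i w)).
Proof.
move=> fi.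
have : P.-integrable setT (fun w => \sum_(i <- s) (f i w)%:E)%E.
  by apply: integrable_sum => // i _; exact: fi.
by apply: eq_integrable => // w _ /=; rewrite sumEFin.
Qed.

Lemma integral_indicM (A : set T) (f : T -> R) :
  (\int[P]_w (\1_A w * f w)%:E = \int[P]_(w in A) (f w)%:E)%E.
Proof.
rewrite [RHS]integral_mkcond; apply: eq_integral => w _; rewrite patchE indicE.
by case: ifP => _; rewrite ?mul1r ?mul0r.
Qed.

(** The products [c i * X i] need not be integrable, so [X] is exchanged for [Y] on events where all
    coefficients are at most [k]. Monotone convergence in [k] for the nonnegative [L'] then reaches
    all of [A]. *)
Lemma supermartingale_step (I : finType) (X Y c : I -> T -> R) (c0 L L' : T -> R) :
  (forall i, cond_expectation P G (X i) (Y i)) ->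
  (forall i, measurable_wrt G (c i)) -> measurable_wrt G c0 ->
  P.-integrable setT (EFin \o L) -> (forall w, 0 <= L w) ->
  measurable_fun setT L' -> (forall w, 0 <= L' w) ->
  {ae P, forall w, L' w <= c0 w + \sum_i c i w * X i w} ->
  (forall w, c0 w + \sum_i c i w * Y i w <= L w) ->
  forall A, G A ->
  (\int[P]_(w in A) (L' w)%:E <= \int[P]_(w in A) (L w)%:E)%E.
Proof.
move=> XY mc mc0 Li L0 mL' L'0 L'X YL A GA; have mA := GT GA.
(* A single function dominating all coefficients, so that one sublevel set bounds them together. *)
pose b w := `|c0 w| + \sum_i `|c i w|.
have mb : measurable_wrt G b.
  apply: measurable_funD; first exact: (measurableT_comp (@normr_measurable R setT) mc0).
  by apply: measurable_sumr => i; exact: (measurableT_comp (@normr_measurable R setT) (mc i)).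
pose B (k : nat) := [set w | b w <= k%:R].
have mB k : (@measurable _ (g_sigma_algebraType G)) (B k).
  have := measurable_wrt_preimage sG mb (measurable_itv `]-oo, k%:R]).
  by rewrite preimage_itvNyc (g_sigma_measurableE sG).
pose F k := A `&` B k.
have GF k : G (F k).
  rewrite -(g_sigma_measurableE sG); apply: measurableI => //.
  by rewrite (g_sigma_measurableE sG).
have mF k : measurable (F k) by exact: GT.
have step k : (\int[P]_(w in F k) (L' w)%:E <= \int[P]_(w in A) (L w)%:E)%E.
  pose h i w : R := \1_(F k) w * c i w.
  pose h0 w : R := \1_(F k) w * c0 w.
  have mI : measurable_wrt G (\1_(F k) : T -> R) by exact: measurable_wrt_indic.
  have mh i : measurable_wrt G (h i) by exact: (measurable_funM mI (mc i)).
  have mh0 : measurable_wrt G h0 by exact: (measurable_funM mI mc0).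
  have bE w : F k w -> `|c0 w| <= k%:R /\ forall i, `|c i w| <= k%:R.
    move=> [_]; rewrite /B /= /b => bk; split.
      by apply: le_trans bk; rewrite lerDl sumr_ge0.
    move=> i; apply: le_trans bk; rewrite (bigD1 i) //= addrCA lerDl.
    by rewrite addr_ge0 // sumr_ge0.
  have hk i w : `|h i w| <= k%:R.
    rewrite /h indicE; case: (boolP (w \in F k)) => [/set_mem /bE [_ ci]|_].
      by rewrite mul1r.
    by rewrite mul0r normr0.
  have h0k w : `|h0 w| <= k%:R.
    rewrite /h0 indicE; case: (boolP (w \in F k)) => [/set_mem /bE [c0k _]|_].
      by rewrite mul1r.
    by rewrite mul0r normr0.
  have h0i : P.-integrable setT (EFin \o h0).
    apply: measurable_bounded_integrable => //.
    - by apply: le_lt_trans (probability_le1 P measurableT) (ltry _).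
    - exact: (measurable_wrtW sG GT mh0).
    exists k%:R; split; first exact: num_real.
    by move=> x kx w _; exact: le_trans (h0k w) (ltW kx).
  have hXi i : P.-integrable setT (EFin \o (fun w => h i w * X i w)).
    have [Xi _ _ _] := XY i.
    by apply: (integrable_boundedM _ (hk i)) => //; exact: (measurable_wrtW sG GT (mh i)).
  have hYi i : P.-integrable setT (EFin \o (fun w => h i w * Y i w)).
    have [_ _ Yi _] := XY i.
    by apply: (integrable_boundedM _ (hk i)) => //; exact: (measurable_wrtW sG GT (mh i)).
  have hsE (Z : I -> T -> R) : (forall i, P.-integrable setT (EFin \o (fun w => h i w * Z i w))) ->
      (\int[P]_w (h0 w + \sum_i h i w * Z i w)%:E =
       \int[P]_w (h0 w)%:E + \sum_i \int[P]_w (h i w * Z i w)%:E)%E.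
    move=> hZi; rewrite integralD_EFin //; last exact: integrable_sumr.
    congr (_ + _)%E; rewrite -(integral_sum measurableT hZi).
    by apply: eq_integral => w _; rewrite /= sumEFin.
  have hsi (Z : I -> T -> R) : (forall i, P.-integrable setT (EFin \o (fun w => h i w * Z i w))) ->
      P.-integrable setT (EFin \o (fun w => h0 w + \sum_i h i w * Z i w)).
    move=> hZi; have := integrableD measurableT h0i (integrable_sumr (index_enum I) hZi).
    exact: eq_integrable.
  have indS (Z : I -> T -> R) w : h0 w + \sum_i h i w * Z i w =
      \1_(F k) w * (c0 w + \sum_i c i w * Z i w).
    by rewrite mulrDr mulr_sumr; congr (_ + _); apply: eq_bigr => i _; rewrite mulrA.
  have mI' : measurable_fun setT (\1_(F k) : T -> R) by exact: measurable_indic.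
  have ind0 w : 0 <= \1_(F k) w :> R by rewrite indicE.
  apply: (@le_trans _ _ (\int[P]_w (h0 w + \sum_i h i w * X i w)%:E)%E).
    have mf := measurable_int P (hsi X hXi).
    have mf' : measurable_fun setT (fun w => h0 w + \sum_i h i w * X i w).
      by apply/measurable_EFinP.
    (* The right-hand side is known to be nonnegative only almost surely, while the comparison lemma
       asks for it everywhere; the positive part agrees with it almost everywhere. *)
    pose f' w := Num.max (h0 w + \sum_i h i w * X i w) 0.
    have mf'' : measurable_fun setT f'.
      by apply: measurable_maxr => //; exact: measurable_cst.
    have ae1 : {ae P, forall w, [set: T] w ->
        (\1_(F k) w * L' w <= h0 w + \sum_i h i w * X i w)}.
      by apply: filterS L'X => w le _; rewrite indS ler_wpM2l.
    rewrite -integral_indicM.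
    apply: (@le_trans _ _ (\int[P]_w (f' w)%:E)%E).
      apply: ae_ge0_le_integral => //.
      - by move=> w _; rewrite lee_fin mulr_ge0.
      - by apply/measurable_EFinP; exact: measurable_funM.
      - by move=> w _; rewrite lee_fin le_max lexx orbT.
      - by apply/measurable_EFinP.
      by apply: filterS ae1 => w le _; rewrite lee_fin le_max le.
    rewrite le_eqVlt; apply/orP; left; apply/eqP; apply: ae_eq_integral => //.
      by apply/measurable_EFinP.
    apply: filterS ae1 => w le _; congr EFin; rewrite /f' max_l //.
    by apply: le_trans (le Logic.I); rewrite mulr_ge0.
  rewrite hsE //.
  under eq_bigr do rewrite (cond_expectationM sG GT (XY _) (mh _) (hk _)).
  rewrite -hsE //.
  apply: (@le_trans _ _ (\int[P]_w (\1_(F k) w * L w)%:E)%E).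
    apply: le_integral => //; first exact: hsi.
      apply: (@integrable_boundedM _ _ _ _ _ _ 1) => // w.
      by rewrite indicE; case: (_ \in _); rewrite /= ?normr1 ?normr0.
    by move=> w _; rewrite lee_fin indS ler_wpM2l.
  rewrite integral_indicM; apply: ge0_subset_integral => //.
  - by apply: measurable_funTS; exact: measurable_int Li.
  - by move=> w _; rewrite lee_fin.
  - by move=> w [].
have nF : nondecreasing_seq F.
  move=> k l kl; apply/subsetPset => w [Aw Bw]; split => //.
  by apply: le_trans Bw _; rewrite ler_nat.
have AE : A = \bigcup_k F k.
  apply/seteqP; split => [w Aw|w [k _ []//]].
  exists (Num.truncn (b w)).+1 => //; split => //.
  by apply/ltW; exact: truncnS_gt.
have L'E : (\int[P]_(w in F k) (L' w)%:E)%E @[k --> \oo] --> (\int[P]_(w in A) (L' w)%:E)%E.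
  rewrite AE; apply: ge0_nondecreasing_set_cvg_integral => //.
  - by move=> k; apply: measurable_funTS; apply/measurable_EFinP.
  - by move=> k w _; rewrite lee_fin.
by apply: cvge_to_le L'E _; apply: nearW.
Qed.

(** The set where [Y] exceeds [L] lies in [G]. There the nonnegative excess has an integral at most
    0, hence vanishes almost everywhere. *)
Lemma supermartingale_ae (L L' : T -> R) :
  measurable_wrt G L -> P.-integrable setT (EFin \o L) ->
  P.-integrable setT (EFin \o L') ->
  (forall A, G A -> (\int[P]_(w in A) (L' w)%:E <= \int[P]_(w in A) (L w)%:E)%E) ->
  exists2 Y, cond_expectation P G L' Y & {ae P, forall w, Y w <= L w}.
Proof.
move=> mL Li L'i L'L; have [Y YL'] := cond_expectation_exists L'i.
exists Y => //; have [_ mY Yi YE] := YL'.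
pose A := [set w | L w < Y w].
have GA : G A.
  have mD : measurable_wrt G (fun w => Y w - L w) by exact: (measurable_funB mY mL).
  have := measurable_wrt_preimage sG mD (measurable_itv `]0, +oo[).
  by rewrite preimage_itvoy; congr G; apply/seteqP; split => w /=; rewrite subr_gt0.
have mA := GT GA.
pose D w := \1_A w * (Y w - L w).
have D0 w : 0 <= D w.
  rewrite /D indicE; case: (boolP (w \in A)) => [/set_mem /ltW Aw|_].
    by rewrite mul1r subr_ge0.
  by rewrite mul0r.
have Di : P.-integrable setT (EFin \o D).
  apply: (@integrable_boundedM _ _ _ _ _ _ 1); first exact: measurable_indic.
    by move=> w; rewrite indicE; case: (_ \in _); rewrite /= ?normr1 ?normr0.
  exact: integrable_subr.
have DI0 : (\int[P]_w (D w)%:E = 0)%E.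
  apply/eqP; rewrite eq_le integral_ge0 ?andbT; last by move=> w _; rewrite lee_fin.
  rewrite /D integral_indicM integralB_EFin //; try exact: integrableS measurableT _ _ _.
  by rewrite YE // sube_le0 ?L'L.
have mDe : measurable_fun setT (EFin \o D) by exact: measurable_int Di.
have : ae_eq P setT (EFin \o D) (cst 0%E).
  apply/(ae_eq_integral_abs P measurableT mDe); rewrite -[RHS]DI0.
  by apply: eq_integral => w _ /=; rewrite ger0_norm.
apply: filterS => w /(_ Logic.I) [].
rewrite /D indicE; case: (boolP (w \in A)) => [/set_mem Aw|/negP wA _].
  by rewrite mul1r => /eqP; rewrite subr_eq0 => /eqP ->.
by rewrite leNgt; apply/negP => Aw; apply: wA; exact: mem_set.
Qed.

End ConditionalExpectation.

(** * Ville's inequality *)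

Section Ville.
Context {disp : measure_display} {T : measurableType disp} {R : realType}.
Variables (P : probability T R) (F : nat -> set (set T)) (L : nat -> T -> R).
Hypothesis FF : filtration F.
Hypothesis mL : forall n, measurable_wrt (F n) (L n).
Hypothesis L0 : forall n w, 0 <= L n w.
Hypothesis L_le : forall n A, F n A ->
  (\int[P]_(w in A) (L n.+1 w)%:E <= \int[P]_(w in A) (L n w)%:E)%E.

Theorem ville (a c : R) : (\int[P]_w (L 0%N w)%:E <= a%:E)%E -> 0 < c ->
  (P [set w | exists n, (c <= L n w)%R] <= (a / c)%:E)%E.
Proof.
move=> La c0; have [sF FT Fm] := FF.
pose S n := [set w | c <= L n w].
have FS n : F n (S n) by exact: measurable_wrt_ge.
(* [E n] is the event that level [c] has been reached by time [n]. *)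
pose fix E n := if n is m.+1 then E m `|` S m.+1 else S 0%N.
have mF n A : (@measurable _ (g_sigma_algebraType (F n)) A : Prop) <-> F n A.
  by rewrite (g_sigma_measurableE (sF n)).
have FE n : F n (E n).
  elim: n => [|n IH]; first exact: FS.
  apply/mF; apply: measurableU; apply/mF; last exact: FS.
  exact: Fm IH.
have mE n : measurable (E n) by exact: FT (FE n).
have mS n : measurable (S n) by exact: FT (FS n).
have mLT n : measurable_fun setT (EFin \o L n).
  by apply/measurable_EFinP; apply: (measurable_wrtW (sF n)) => //; exact: FT.
have mLA n (A : set T) : measurable_fun A (EFin \o L n).
  exact: measurable_funTS.
have markov n (A : set T) : measurable A -> A `<=` S n ->
    (c%:E * P A <= \int[P]_(w in A) (L n w)%:E)%E.
  move=> mA AS; rewrite -integral_cst //.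
  apply: ge0_le_integral => //.
  - by move=> w _; rewrite lee_fin ltW.
  - exact: mLA.
(* Invariant: a path that has reached the level is worth [c] from then on, the others keep their
   current value, and the expected total stays at most [a]. *)
have key n : (c%:E * P (E n) + \int[P]_(w in ~` E n) (L n w)%:E <= a%:E)%E.
  elim: n => [|n IH].
    apply: le_trans La; rewrite -[X in (_ <= \int[P]_(_ in X) _)%E](setUv (S 0%N)).
    rewrite ge0_integral_setU //; last 4 first.
    - exact: measurableC.
    - exact: mLA.
    - by move=> w _; rewrite lee_fin.
    - by rewrite disj_set2E setICr.
    by apply: leeD => //; exact: markov.
  apply: le_trans IH.
  (* The paths reaching the level for the first time at [n.+1]. *)
  pose D := ~` E n `&` S n.+1.
  have mD : measurable D by apply: measurableI => //; exact: measurableC.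
  have EU : E n.+1 = E n `|` D.
    by rewrite /= /D setUIr setUCr setTI.
  have CE : ~` E n = D `|` ~` E n.+1.
    rewrite /= setCU /D -setIUr setUCr setIT //.
  rewrite [X in (c%:E * P X)%E]EU measureU //; last first.
    by rewrite /D setIA setICr set0I.
  rewrite ge0_muleDr // -addeA; apply: leeD => //.
  apply: le_trans (L_le _); last first.
    apply/mF; apply: measurableC; exact/mF.
  rewrite CE ge0_integral_setU //; last 4 first.
  - exact: measurableC.
  - exact: mLA.
  - by move=> w _; rewrite lee_fin.
  - by rewrite disj_set2E EU setCU setICA setICr setI0.
  by apply: leeD => //; apply: markov => // w [].
have PE n : (P (E n) <= (a / c)%:E)%E.
  have : (c%:E * P (E n) <= a%:E)%E.
    apply: le_trans (key n); rewrite leeDl // integral_ge0 // => w _.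
    by rewrite lee_fin.
  by rewrite EFinM lee_pdivlMr // muleC.
have -> : [set w | exists n, c <= L n w] = \bigcup_n E n.
  apply/seteqP; split => [w [n Lw]|w [n _]].
    by exists n => //; case: n Lw => //= n Lw; right.
  by elim: n => [|n IH] /= => [Sw|[/IH//|Sw]]; [exists 0%N|exists n.+1].
have nE : nondecreasing_seq E.
  by apply/nondecreasing_seqP => n; apply/subsetPset => w; left.
have := @nondecreasing_cvg_mu _ _ _ P E mE (bigcupT_measurable _ mE) nE.
by move/cvge_to_le; apply; apply: nearW => n; exact: PE.
Qed.

End Ville.

(** * The exponential supermartingale *)

Lemma measurable_wrtS (disp : measure_display) (T : measurableType disp)
    (R : realType) (G G' : set (set T)) (f : T -> R) :
  sigma_algebra [set: T] G -> sigma_algebra [set: T] G' -> G `<=` G' ->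
  measurable_wrt G f -> measurable_wrt G' f.
Proof.
move=> sG sG' GG' mf _ Y mY; rewrite (measurable_g_measurableTypeE sG').
by apply: GG'; rewrite -(measurable_g_measurableTypeE sG); exact: mf.
Qed.

Section ExponentialSupermartingale.
Context {disp : measure_display} {T : measurableType disp} {R : realType}.
Variables (P : probability T R) (F : nat -> set (set T)) (F_filtration : filtration F).
Variables (d : nat) (X M Xhat : nat -> T -> 'M[R]_d.+1) (gamma : nat -> T -> R).
Hypothesis X_sym : forall n w, (0 < n)%N -> X n w \is symmetricmx.
Hypothesis X_adapted : forall n, (0 < n)%N -> mx_measurable_wrt (F n) (X n).
Hypothesis M_sym : forall n w, (0 < n)%N -> M n w \is symmetricmx.
Hypothesis M_condmean : forall n, (0 < n)%N -> mx_cond_expectation P (F n.-1) (X n) (M n).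
Hypothesis Xhat_sym : forall n w, (0 < n)%N -> Xhat n w \is symmetricmx.
Hypothesis Xhat_predictable : forall n, (0 < n)%N -> mx_measurable_wrt (F n.-1) (Xhat n).
Hypothesis X_lower : forall n, (0 < n)%N ->
  {ae P, forall w, -1 <= lambda_min (X n w - Xhat n w)}.
Hypothesis gamma_predictable : forall n, (0 < n)%N -> measurable_wrt (F n.-1) (gamma n).
Hypothesis gamma01 : forall n w, (0 < n)%N -> 0 < gamma n w < 1.

Let sF n : sigma_algebra [set: T] (F n). Proof. by case: F_filtration. Qed.
Let FT n : F n `<=` @measurable _ T. Proof. by case: F_filtration. Qed.
Let Fm m n : (m <= n)%N -> F m `<=` F n. Proof. by case: F_filtration => _ _; exact. Qed.

Definition wdev n w : 'M[R]_d.+1 := \sum_(1 <= i < n.+1) gamma i w *: (X i w - M i w).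
Definition wexp n w := wdev n w - wvar gamma X Xhat n w.
Definition trexp n w : R := \tr (expmx (wexp n w)).

Let trsym n w : (0 < n)%N -> [/\ (X n w)^T = X n w, (M n w)^T = M n w & (Xhat n w)^T = Xhat n w].
Proof. by move=> n0; split; apply/symmetricP; auto. Qed.

Let wdev_sym n w : (wdev n w)^T = wdev n w.
Proof.
rewrite /wdev linear_sum /= [LHS]big_nat [RHS]big_nat; apply: eq_bigr => i /andP[i0 _].
by have [XE ME _] := trsym w i0; rewrite linearZ linearB /= XE ME.
Qed.

Let wvar_sym n w : (wvar gamma X Xhat n w)^T = wvar gamma X Xhat n w.
Proof.
rewrite /wvar linear_sum /= [LHS]big_nat [RHS]big_nat; apply: eq_bigr => i /andP[i0 _].
have [XE _ HE] := trsym w i0; rewrite linearZ /= expr2; congr (_ *: _).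
by rewrite -[X in X^T]/(_ *m _) trmx_mul linearB /= XE HE.
Qed.

Let wexp_sym n w : (wexp n w)^T = wexp n w.
Proof. by rewrite linearB /= wdev_sym wvar_sym. Qed.

Let wrt_mono m n (f : T -> R) : (m <= n)%N -> measurable_wrt (F m) f -> measurable_wrt (F n) f.
Proof. by move=> mn; apply: measurable_wrtS => //; exact: Fm. Qed.

(** Puts measurability with respect to [F n] in the form of the general lemmas on
    [measurable_mx]. *)
Notation mx_wrt n A := (@measurable_mx _ (g_sigma_algebraType (F n)) R _ _ A).

(** Predictability lets the index reach [n.+1], one beyond what [mX] grants; [mXhat] and [mM] share
    this range. *)
Let mgamma i n : (0 < i)%N -> (i <= n.+1)%N -> measurable_wrt (F n) (gamma i).
Proof.
by move=> i0 iN; apply: wrt_mono (gamma_predictable i0); rewrite -ltnS prednK.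
Qed.

Let mXhat i n : (0 < i)%N -> (i <= n.+1)%N -> mx_wrt n (Xhat i).
Proof.
move=> i0 iN k l; apply: wrt_mono (Xhat_predictable i0 k l).
by rewrite -ltnS prednK.
Qed.

Let mM i n : (0 < i)%N -> (i <= n.+1)%N -> mx_wrt n (M i).
Proof.
move=> i0 iN k l; have [_ mMi _ _] := M_condmean i0 k l.
by apply: wrt_mono mMi; rewrite -ltnS prednK.
Qed.

Let mX i n : (0 < i)%N -> (i <= n)%N -> mx_wrt n (X i).
Proof. by move=> i0 iN k l; exact: wrt_mono (X_adapted i0 k l). Qed.

Let measurable_nat n (f : nat -> T -> R) :
  (forall i, (0 < i)%N -> (i <= n)%N -> measurable_wrt (F n) (f i)) ->
  measurable_wrt (F n) (fun w => \sum_(1 <= i < n.+1) f i w).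
Proof.
(* Terms outside the range are replaced by 0, since [measurable_sumr] asks for measurability at
   every index. *)
move=> mf; rewrite (_ : (fun w => _) =
   fun w => \sum_(i <- index_iota 1 n.+1) if (0 < i <= n)%N then f i w else 0).
  apply: (@measurable_sumr _ (g_sigma_algebraType (F n))) => i.
  by case: (boolP (0 < i <= n)%N) => [/andP[i0 iN]|_]; [exact: mf|exact: measurable_cst].
apply/funext => w; rewrite [LHS]big_nat [RHS]big_nat.
by apply: eq_bigr => i; rewrite ltnS => ->.
Qed.

Let measurable_mx_nat n (A : nat -> T -> 'M[R]_d.+1) :
  (forall i, (0 < i)%N -> (i <= n)%N -> mx_wrt n (A i)) ->
  mx_wrt n (fun w => \sum_(1 <= i < n.+1) A i w).
Proof.
move=> mA k l; under eq_fun do rewrite summxE.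
by apply: measurable_nat => i i0 iN; exact: mA.
Qed.

Let mwdev n : mx_wrt n (wdev n).
Proof.
apply: measurable_mx_nat => i i0 iN; apply: measurable_mxZ.
  by apply: mgamma => //; exact: leqW.
by apply: measurable_mxB; [exact: mX|apply: mM => //; exact: leqW].
Qed.

Let mwvar n : mx_wrt n (wvar gamma X Xhat n).
Proof.
apply: measurable_mx_nat => i i0 iN; apply: measurable_mxZ.
  by apply: measurable_psiE; apply: mgamma => //; exact: leqW.
apply: measurable_mxX; apply: measurable_mxB; first exact: mX.
by apply: mXhat => //; exact: leqW.
Qed.

Let mwexp n : mx_wrt n (wexp n).
Proof. by apply: (@measurable_mxB _ (g_sigma_algebraType (F n))); [exact: mwdev|exact: mwvar]. Qed.

Lemma trexp_measurable n : measurable_wrt (F n) (trexp n).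
Proof.
have := @measurable_mxtrace _ (g_sigma_algebraType (F n)) R _ (fun w => expmx (wexp n w)).
by apply; apply: measurable_expmx => //; exact: mwexp.
Qed.

Let mTtrexp n : measurable_fun [set: T] (trexp n).
Proof. exact: (measurable_wrtW (sF n) (@FT n) (@trexp_measurable n)). Qed.

Lemma trexp_ge0 n w : 0 <= trexp n w.
Proof.
have /andP[le _] := mxtrace_expmx_bounds (wexp_sym n w).
exact: le_trans (expR_ge0 _) le.
Qed.

Lemma trexp0 w : trexp 0 w = d.+1%:R.
Proof.
rewrite /trexp /wexp /wdev /wvar !big_geq // subrr.
have I1 : 1%:M *m (1%:M : 'M[R]_d.+1)^T = 1%:M by rewrite trmx1 mulmx1.
have -> : 0 = sdiag 1%:M 0 :> 'M[R]_d.+1.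
  by rewrite /sdiag linear0 mulmx0 mul0mx.
rewrite expmx_sdiag // mxtrace_sdiag //.
under eq_bigr do rewrite !mxE expR0.
by rewrite sumr_const card_ord.
Qed.

(** Writing [X - M] as [(X - Xhat) - (M - Xhat)] separates the increment into a predictable part and
    the exponent of Fan's inequality. *)
Lemma wexpS n w : wexp n.+1 w =
  wexp n w - gamma n.+1 w *: (M n.+1 w - Xhat n.+1 w) +
  (gamma n.+1 w *: (X n.+1 w - Xhat n.+1 w)
   - psiE (gamma n.+1 w) *: (X n.+1 w - Xhat n.+1 w) ^+ 2).
Proof.
rewrite /wexp /wdev /wvar !(@big_nat_recr _ _ _ n.+1) //=.
set a := \sum_(_ <= _ < _) _; set b := \sum_(_ <= _ < _) _; set c := psiE _ *: _.
have -> : gamma n.+1 w *: (X n.+1 w - M n.+1 w) =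
  gamma n.+1 w *: (X n.+1 w - Xhat n.+1 w) - gamma n.+1 w *: (M n.+1 w - Xhat n.+1 w).
  by rewrite -scalerBr opprB addrA subrK.
move: (gamma n.+1 w *: (X _ w - _)) (gamma n.+1 w *: (M _ w - _)) => x y.
rewrite opprD addrACA -[RHS]addrA; congr (_ + _).
by rewrite addrA [- y + x]addrC.
Qed.

Lemma trexp_integral_le n : P.-integrable setT (EFin \o trexp n) ->
  forall A, F n A ->
  (\int[P]_(w in A) (trexp n.+1 w)%:E <= \int[P]_(w in A) (trexp n w)%:E)%E.
Proof.
move=> Li.
pose B w := gamma n.+1 w *: (M n.+1 w - Xhat n.+1 w).
have Bs w : (B w)^T = B w.
  by have [_ ME HE] := @trsym n.+1 w erefl; rewrite linearZ linearB /= ME HE.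
pose C w := lieb_mx (expmx (wexp n w)) (expmx (B w)).
have mB : mx_wrt n B.
  apply: measurable_mxZ; first exact: mgamma.
  by apply: measurable_mxB; [exact: mM|exact: mXhat].
have mC : mx_wrt n C.
  by apply: measurable_lieb_mx.
(* The trace is affine in the entries of [Y], with coefficients measurable for [F n]. It is used
   with [Y] equal to [X n.+1] and to its conditional mean [M n.+1], the latter giving
   [\tr (C (1 + B))]. *)
have trE (Y : T -> 'M[R]_d.+1) w : \tr (C w *m (1%:M + gamma n.+1 w *: (Y w - Xhat n.+1 w))) =
  \tr (C w *m (1%:M - gamma n.+1 w *: Xhat n.+1 w)) +
  \sum_(p : 'I_d.+1 * 'I_d.+1) (gamma n.+1 w * C w p.2 p.1) * Y w p.1 p.2.
  have -> : 1%:M + gamma n.+1 w *: (Y w - Xhat n.+1 w) =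
      1%:M - gamma n.+1 w *: Xhat n.+1 w + gamma n.+1 w *: Y w.
    by rewrite scalerBr [gamma n.+1 w *: Y w - _]addrC addrA.
  rewrite mulmxDr linearD /=; congr (_ + _).
  rewrite -scalemxAr linearZ /= mxtrace_mulE exchange_big /=.
  rewrite mulr_sumr -(pair_bigA _ (fun i j => gamma n.+1 w * C w j i * Y w i j)) /=.
  by apply: eq_bigr => i _; rewrite mulr_sumr; apply: eq_bigr => j _; rewrite mulrA.
apply: (@supermartingale_step _ _ _ P (F n) (sF n) (@FT n) _
  (fun p w => X n.+1 w p.1 p.2) (fun p w => M n.+1 w p.1 p.2)
  (fun p w => gamma n.+1 w * C w p.2 p.1)
  (fun w => \tr (C w *m (1%:M - gamma n.+1 w *: Xhat n.+1 w)))) => //.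
- by move=> p; exact: (@M_condmean n.+1 erefl p.1 p.2).
- move=> p; apply: (@measurable_funM _ (g_sigma_algebraType (F n))); first exact: mgamma.
  exact: mC.
- apply: (@measurable_mxtrace _ (g_sigma_algebraType (F n))).
  apply: measurable_mxM => //; apply: measurable_mxB; first exact: measurable_mx_cst.
  by apply: measurable_mxZ; [exact: mgamma|exact: mXhat].
- exact: trexp_ge0.
- exact: trexp_ge0.
- apply: filterS (@X_lower n.+1 erefl) => w lo.
  rewrite -trE /trexp wexpS; apply: mxtrace_expmx_step.
  + exact: wexp_sym.
  + exact: Bs.
  + by have [XE _ HE] := @trsym n.+1 w erefl; rewrite linearB /= XE HE.
  + exact: gamma01.
  + exact: lo.
- move=> w; rewrite -trE; exact: mxtrace_lieb_mx_le.
Qed.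

(** By induction: the one-step inequality on the whole space bounds the integral of the next
    nonnegative term, starting from the constant [d.+1]. *)
Lemma trexp_integrable n : P.-integrable setT (EFin \o trexp n).
Proof.
elim: n => [|n IH].
  rewrite (_ : EFin \o _ = cst (d.+1%:R)%:E); last by apply/funext => w /=; rewrite trexp0.
  exact: finite_measure_integrable_cst.
apply/integrableP; split; first by apply/measurable_EFinP.
rewrite (eq_integral (EFin \o trexp n.+1)); last first.
  by move=> w _ /=; rewrite ger0_norm // trexp_ge0.
have FnT : F n [set: T].
  by case: (sF n) => s0 sC _; have := sC _ s0; rewrite setD0.
apply: le_lt_trans (trexp_integral_le IH FnT) _.
have /integrableP [_] := IH; rewrite (eq_integral (EFin \o trexp n)) // => w _ /=.
by rewrite ger0_norm // trexp_ge0.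
Qed.

Lemma trexp_supermartingale : supermartingale P F trexp.
Proof.
split; [exact: trexp_measurable|exact: trexp_integrable|].
move=> n; apply: (supermartingale_ae (sF n) (@FT n)).
- exact: trexp_measurable.
- exact: trexp_integrable.
- exact: trexp_integrable.
- by apply: trexp_integral_le; exact: trexp_integrable.
Qed.

Definition deviation_event alpha n := [set w |
  (ln (d.+1%:R / alpha) + lambda_max (wvar gamma X Xhat n w)) / wsum gamma n w
    <= lambda_max (wmean gamma X n w - wmean gamma M n w)].

Let wsum_gt0 n w : (0 < n)%N -> 0 < wsum gamma n w.
Proof.
case: n => // n _; rewrite /wsum big_nat_recr //= ltr_wpDl //.
  by rewrite big_nat sumr_ge0 // => i /andP[i0 _]; have /andP[/ltW] := gamma01 w i0.
by have /andP[] := @gamma01 n.+1 w erefl.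
Qed.

Let wmeanB n w : wmean gamma X n w - wmean gamma M n w = (wsum gamma n w)^-1 *: wdev n w.
Proof.
rewrite /wmean -scalerBr -sumrB; congr (_ *: _).
by apply: eq_bigr => i _; rewrite scalerBr.
Qed.

(** Clearing the positive weight leaves a lower bound on [lambda_max S - lambda_max V], hence on
    [lambda_max (S - V)], whose exponential is at most the trace. *)
Lemma deviation_event_trexp alpha n w : 0 < alpha -> (0 < n)%N ->
  deviation_event alpha n w -> d.+1%:R / alpha <= trexp n w.
Proof.
move=> a0 n0; rewrite /deviation_event /= wmeanB.
have s0 := wsum_gt0 w n0.
rewrite lambda_maxZ ?invr_gt0 // mulrC ler_pM2l ?invr_gt0 // => le.
have da : 0 < d.+1%:R / alpha by rewrite divr_gt0 // ltr0Sn.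
have /andP[+ _] := mxtrace_expmx_bounds (wexp_sym n w).
apply: le_trans; rewrite -[leLHS]lnK ?posrE // ler_expR.
have := lambda_max_subadd (wdev_sym n w) (wvar_sym n w); rewrite -/(wexp n w).
by apply: le_trans; rewrite lerBrDr.
Qed.

Lemma deviation_event_measurable alpha n : (0 < n)%N ->
  measurable (deviation_event alpha n).
Proof.
move=> n0; apply: (@FT n).
have mW : measurable_wrt (F n) (fun w => (wsum gamma n w)^-1).
  apply: (@measurable_funV _ (g_sigma_algebraType (F n))) => [|w]; last exact: wsum_gt0.
  by apply: measurable_nat => i i0 iN; apply: mgamma => //; exact: leqW.
have mV : measurable_wrt (F n) (fun w => lambda_max (wvar gamma X Xhat n w)).
  apply: (@measurable_lambda_max _ (g_sigma_algebraType (F n))); first exact: wvar_sym.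
  exact: mwvar.
have mD : measurable_wrt (F n) (fun w => lambda_max (wmean gamma X n w - wmean gamma M n w)).
  apply: (@measurable_lambda_max _ (g_sigma_algebraType (F n))).
    by move=> w; rewrite wmeanB linearZ /= wdev_sym.
  apply: (@eq_measurable_mx _ (g_sigma_algebraType (F n)) _ _ _
    (fun w => (wsum gamma n w)^-1 *: wdev n w)); first by move=> w; rewrite wmeanB.
  by apply: measurable_mxZ => //; exact: mwdev.
have mB : measurable_wrt (F n) (fun w =>
    lambda_max (wmean gamma X n w - wmean gamma M n w)
    - (ln (d.+1%:R / alpha) + lambda_max (wvar gamma X Xhat n w)) / wsum gamma n w).
  apply: (measurable_funB mD); apply: measurable_funM => //.
  by apply: measurable_funD => //; exact: measurable_cst.
have := measurable_wrt_ge (sF n) 0 mB; congr F.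
by apply/seteqP; split => w; rewrite /deviation_event /= subr_ge0.
Qed.

Lemma deviation_measurable alpha :
  measurable [set w | exists n, (0 < n)%N /\ deviation_event alpha n w].
Proof.
rewrite (_ : mkset _ = \bigcup_n if (0 < n)%N then deviation_event alpha n else set0).
  apply: bigcupT_measurable => n; case: ifP => n0 //.
  exact: deviation_event_measurable.
apply/seteqP; split => [w [n [n0 En]]|w [n _]]; first by exists n => //; rewrite n0.
by case: ifPn => // n0 En; exists n.
Qed.

(** Ville's inequality at level [d.+1 / alpha], from the initial value [d.+1], gives the ratio
    [alpha]. *)
Theorem deviation_probability alpha : 0 < alpha < 1 ->
  (P [set w | exists n, (0 < n)%N /\ deviation_event alpha n w] <= alpha%:E)%E.
Proof.
move=> /andP[a0 _].
have c0 : 0 < d.+1%:R / alpha by rewrite divr_gt0 // ltr0Sn.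
have La : (\int[P]_w (trexp 0 w)%:E <= d.+1%:R%:E)%E.
  rewrite (eq_integral (cst d.+1%:R%:E)) => [|w _]; last by rewrite trexp0.
  have PT : P [set: T] = 1%E := probability_setT P.
  by rewrite integral_cst //= [X in (_ * X)%E]PT mule1.
have : (P [set w | exists n, (d.+1%:R / alpha <= trexp n w)%R]
    <= (d.+1%:R / (d.+1%:R / alpha))%:E)%E.
  apply: (@ville _ _ _ P F trexp F_filtration _ _ _ _ _ La c0).
  - exact: trexp_measurable.
  - exact: trexp_ge0.
  - by move=> n; apply: trexp_integral_le; exact: trexp_integrable.
rewrite invf_div mulrCA divff ?mulr1 ?pnatr_eq0 //; apply: le_trans.
apply: le_measure; rewrite ?inE.
- exact: deviation_measurable.
- rewrite (_ : mkset _ = \bigcup_n [set w | d.+1%:R / alpha <= trexp n w]).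
    apply: bigcupT_measurable => n; apply: (@FT n).
    exact: (measurable_wrt_ge (sF n) _ (@trexp_measurable n)).
  by apply/seteqP; split => [w [n Ln]|w [n _ Ln]]; exists n.
- by move=> w [n [n0 En]]; exists n; exact: deviation_event_trexp.
Qed.

(** The event at [tau] lies inside the event for some [n >= 1]; what remains is its
    measurability. *)
Theorem deviation_probability_stopping (tau : T -> option nat) alpha :
  stopping_time F tau -> (forall w, tau w <> Some 0%N) -> 0 < alpha < 1 ->
  (P [set w | exists n, tau w = Some n /\ deviation_event alpha n w] <= alpha%:E)%E.
Proof.
move=> st tau0 a01; apply: le_trans (deviation_probability a01).
have sub : [set w | exists n, tau w = Some n /\ deviation_event alpha n w] `<=`
    [set w | exists n, (0 < n)%N /\ deviation_event alpha n w].
  move=> w [n [tn En]]; exists n; split => //.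
  by rewrite lt0n; apply/eqP => n0; apply: (tau0 w); rewrite tn n0.
apply: le_measure => //; rewrite ?inE; last exact: deviation_measurable.
pose S n := [set w | exists2 k, tau w = Some k & (k <= n)%N].
have mS n : measurable (S n) by apply: (@FT n); exact: st.
(* The difference of [S n.+1] and [S n] is the event [tau = n.+1]; times start at 1 because [tau]
   avoids 0. *)
rewrite (_ : mkset _ = \bigcup_n ((S n.+1 `\` S n) `&` deviation_event alpha n.+1)).
  apply: bigcupT_measurable => n; apply: measurableI; first exact: measurableD.
  exact: deviation_event_measurable.
apply/seteqP; split => [w [[|n] [tn En]]|w [n _ [[[k tk kn] Sn] En]]].
- by case: (tau0 w).
- exists n => //; split => //; split; first by exists n.+1.
  by move=> [k]; rewrite tn => -[<-]; rewrite ltnn.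
- exists n.+1; split => //; rewrite tk; congr Some; apply/eqP.
  by rewrite eqn_leq kn /= ltnNge; apply/negP => kn'; apply: Sn; exists k.
Qed.

End ExponentialSupermartingale.

Theorem theorem4p2 (disp : measure_display) (T : measurableType disp)
    (R : realType) (P : probability T R)
    (F : nat -> set (set T)) (F_filtration : filtration F)
    (F0_trivial : F 0%N = [set set0; [set: T]])
    (d : nat) (d_gt0 : (0 < d)%N)
    (X M Xhat : nat -> T -> 'M[R]_d) (gamma : nat -> T -> R)
    (X_sym : forall n w, (0 < n)%N -> X n w \is symmetricmx)
    (X_adapted : forall n, (0 < n)%N -> mx_measurable_wrt (F n) (X n))
    (M_sym : forall n w, (0 < n)%N -> M n w \is symmetricmx)
    (M_condmean : forall n, (0 < n)%N ->
       mx_cond_expectation P (F n.-1) (X n) (M n))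
    (Xhat_sym : forall n w, (0 < n)%N -> Xhat n w \is symmetricmx)
    (Xhat_predictable : forall n, (0 < n)%N ->
       mx_measurable_wrt (F n.-1) (Xhat n))
    (Xhat_integrable : forall n, (0 < n)%N -> mx_integrable P (Xhat n))
    (X_lower : forall n, (0 < n)%N ->
       {ae P, forall w, -1 <= lambda_min (X n w - Xhat n w)})
    (gamma_predictable : forall n, (0 < n)%N ->
       measurable_wrt (F n.-1) (gamma n))
    (gamma01 : forall n w, (0 < n)%N -> 0 < gamma n w < 1) :
  [/\ supermartingale P F (fun n w =>
        \tr (expmx (\sum_(1 <= i < n.+1) gamma i w *: (X i w - M i w)
                    - \sum_(1 <= i < n.+1)
                        psiE (gamma i w) *: (X i w - Xhat i w) ^+ 2))),
      forall alpha : R, 0 < alpha < 1 ->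
        (P [set w | exists n, (0 < n)%N /\
             ((ln (d%:R / alpha) + lambda_max (wvar gamma X Xhat n w))
                / wsum gamma n w
              <= lambda_max (wmean gamma X n w - wmean gamma M n w))%R]
         <= alpha%:E)%E &
      forall tau : T -> option nat,
        stopping_time F tau -> (forall w, tau w <> Some 0%N) ->
        forall alpha : R, 0 < alpha < 1 ->
        (P [set w | exists n, tau w = Some n /\
             ((ln (d%:R / alpha) + lambda_max (wvar gamma X Xhat n w))
                / wsum gamma n w
              <= lambda_max (wmean gamma X n w - wmean gamma M n w))%R]
         <= alpha%:E)%E].
Proof.
(* The dimension is put in the form [n.+1], for which the spectrum is nonempty. *)
move: d_gt0 X M Xhat X_sym X_adapted M_sym M_condmean Xhat_sym Xhat_predictable
  Xhat_integrable X_lower; case: d => [//|n] _ X M Xhat X_sym X_adapted M_sym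
  M_condmean Xhat_sym Xhat_predictable _ X_lower.
split.
- exact: (trexp_supermartingale F_filtration X_sym X_adapted M_sym M_condmean
    Xhat_sym Xhat_predictable X_lower gamma_predictable gamma01).
- move=> alpha; exact: (deviation_probability F_filtration X_sym X_adapted M_sym
    M_condmean Xhat_sym Xhat_predictable X_lower gamma_predictable gamma01).
- move=> tau st tau0 alpha; exact: (deviation_probability_stopping F_filtration
    X_sym X_adapted M_sym M_condmean Xhat_sym Xhat_predictable X_lower
    gamma_predictable gamma01 st tau0).
Qed.
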